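(* Assume that $b_n,d_n,p_{n,k}$ are measurable on $A$; that there is $\bar b>0$ with $b_n(a)\le \bar b\,n$ for all $n\in\mathbb{Z}_+,a\in A$; that there is a sequence $(\bar d_n)_{n\in\mathbb{Z}_+}$ in $\mathbb{R}_+$ with $d_n(a)\le \bar d_n$ for all $n,a$; and that there is $M>0$ with $\sum_{k\ge1}k\,p_{n,k}(a)\le M$ for all $n,a$. Then for all $x\in\mathbb{Z}_+$, $\alpha\in\mathcal{A}$, $s\in\mathbb{R}_+$, every $(\mathcal{F}_t)$-stopping time $\tau$ valued in $[0,s]$ and every function $\varphi:\mathbb{Z}_+\to\mathbb{R}_+$, $$\mathbb{E}\left[\varphi\left(X^{x,\alpha}_s\right)\,\middle|\,\mathcal{F}_\tau\right](\bar\omega)=\mathbb{E}\left[\varphi\left(X^{X^{x,\alpha}_\tau(\bar\omega),\,\alpha^{\tau(\bar\omega),\bar\omega}}_{s-\tau(\bar\omega)}\right)\right],\qquad\mathbb{P}(d\bar\omega)\text{-a.s.}$$ (on the right-hand side $\bar\omega$ is frozen and the expectation is over the process started at $X^{x,\alpha}_\tau(\bar\omega)$ and controlled by the shifted control $\alpha^{\tau(\bar\omega),\bar\omega}$).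
   Context: $\mathbb{Z}_+=\{0,1,2,\dots\}$, $\mathbb{N}=\{1,2,\dots\}$. $A$ is a Polish space (control space). For $n\in\mathbb{Z}_+$, $k\in\mathbb{N}$, $b_n,d_n:A\to\mathbb{R}_+$ and $p_{n,k}:A\to[0,1]$ are functions with $\sum_{k\ge1}p_{n,k}(a)=1$ for all $n,a$, and $b_0\equiv d_0\equiv0$. Canonical space: $\mathrm{M}$ is the Polish space (vague topology) of integer-valued locally finite Borel measures on $\mathbb{R}_+\times\mathbb{R}_+$; $\mathcal{M}_s$ is the $\sigma$-algebra on $\mathrm{M}$ generated by $\mu\mapsto\mu(B)$, $B\in\mathcal{B}([0,s])\otimes\mathcal{B}(\mathbb{R}_+)$ bounded; $\Omega=\mathrm{M}\times\mathrm{M}$, $\mathcal{F}_s=\mathcal{M}_s\otimes\mathcal{M}_s$, $\mathbb{P}=\mathbb{Q}\otimes\mathbb{Q}$ with $\mathbb{Q}$ the law of a Poisson random measure on $\mathbb{R}_+\times\mathbb{R}_+$ with Lebesgue intensity; $Q_1(\mu_1,\mu_2)=\mu_1$, $Q_2(\mu_1,\mu_2)=\mu_2$. $\mathcal{A}$ is the set of admissible controls, i.e. $(\mathcal{F}_s)$-predictable $A$-valued processes. With $I_k(n,a)=\big[b_n(a)\sum_{l=1}^{k-1}p_{n,l}(a),\,b_n(a)\sum_{l=1}^{k}p_{n,l}(a)\big)$ and $d(n,a)=d_n(a)$, for $x\in\mathbb{Z}_+$ and $\alpha\in\mathcal{A}$ the controlled process $X^{x,\alpha}$ is the unique (up to indistinguishability)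 càdlàg adapted solution of $$X_s=x+\int_{(0,s]\times\mathbb{R}_+}\sum_{k\ge1}k\mathbf{1}_{I_k(X_{\theta-},\alpha_\theta)}(z)\,Q_1(d\theta,dz)-\int_{(0,s]\times\mathbb{R}_+}\mathbf{1}_{[0,d(X_{\theta-},\alpha_\theta))}(z)\,Q_2(d\theta,dz),\quad s\ge0,\ \mathbb{P}\text{-a.s.}$$ (set to $\infty$ after an accumulation of jumps, which has probability $0$). Shifted control: for $\alpha\in\mathcal{A}$, $t\ge0$, $\bar\omega\in\Omega$, $$\alpha^{t,\bar\omega}_s(\omega)=\alpha_{t+s}\big(Q_1(\bar\omega)\otimes_tQ_1^t(\omega),\,Q_2(\bar\omega)\otimes_tQ_2^t(\omega)\big),\quad s\ge0,\ \omega\in\Omega,$$ where $\mu_1\otimes_t\mu_2=\mu_1|_{[0,t]\times\mathbb{R}_+}+\mu_2|_{(t,\infty)\times\mathbb{R}_+}$ and $\mu^t$ is the image of $\mu$ under $(s,z)\mapsto(t+s,z)$. For fixed $\bar\omega$, $\alpha^{t,\bar\omega}\in\mathcal{A}$. *)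

(* Defs.v *)
(* MathComp-Analysis; the reals are an arbitrary R : realType. *)
From HB Require Import structures.
From mathcomp Require Import all_boot all_order all_algebra.
From mathcomp Require Import all_classical all_reals all_analysis.
From mathcomp Require Import measurable_realfun.
Import Order.TTheory GRing.Theory Num.Theory.
Import numFieldNormedType.Exports.

Set Implicit Arguments.
Unset Strict Implicit.
Unset Printing Implicit Defensive.

Local Open Scope classical_set_scope.
Local Open Scope ring_scope.
Local Open Scope ereal_scope.

Definition polish (R : realType) (A : topologicalType) : Prop :=
  (exists2 D : set A, countable D & dense D) /\
  exists d : A -> A -> R,
    [/\ forall x y, (d x y = 0)%R <-> x = y,
        forall x y, d x y = d y x,
        forall x y z, (d x z <= d x y + d y z)%R,
        forall x, nbhs x =
          filter_from [set e : R | (0 < e)%R] (fun e => [set y | (d x y < e)%R])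
      & forall u : nat -> A,
          (forall e : R, (0 < e)%R -> exists N : nat, forall m n : nat,
             (N <= m)%N -> (N <= n)%N -> (d (u m) (u n) < e)%R) ->
          exists l : A, u @ \oo --> l].

(* Measurability with respect to a sigma-algebra G that need not be the
   canonical one of the domain. *)
Definition measurable_wrt (T : Type) (G : set (set T)) d (U : measurableType d)
    (f : T -> U) : Prop :=
  forall E : set U, measurable E -> G (f @^-1` E).

Definition borel (A : topologicalType) : set (set A) := <<s @open A >>.
Arguments borel : clear implicits.

Definition quadrant (R : realType) : set (R * R) :=
  `[0%R, +oo[%classic `*` `[0%R, +oo[%classic.

Lemma measurable_quadrant (R : realType) : measurable (@quadrant R).
Proof. by apply: measurableX. Qed.

(* Integer-valued locally finite Borel measures on the quadrant, encoded as
   the Borel measures on R * R that do not charge its complement; the first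
   coordinate is time. *)
Record config (R : realType) := Config {
  config_measure :> {measure set (R * R) -> \bar R} ;
  config_supp : config_measure (~` @quadrant R) = 0 ;
  config_int : forall B, measurable B ->
    config_measure B = +oo \/ exists k : nat, config_measure B = k%:R%:E ;
  config_lfin : forall r : R,
    config_measure (`[0%R, r]%classic `*` `[0%R, r]%classic) < +oo }.

Lemma config0_int (R : realType) (B : set (R * R)) : measurable B ->
  (@mzero _ (R * R)%type R) B = +oo \/
  exists k : nat, (@mzero _ (R * R)%type R) B = k%:R%:E.
Proof. by move=> _; right; exists 0%N. Qed.

Lemma config0_lfin (R : realType) (r : R) :
  (@mzero _ (R * R)%type R) (`[0%R, r]%classic `*` `[0%R, r]%classic) < +oo.
Proof. by rewrite /mzero ltry. Qed.

Definition config0 (R : realType) : config R :=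
  @Config R (@mzero _ (R * R)%type R) erefl
    (@config0_int R) (@config0_lfin R).

HB.instance Definition _ (R : realType) := gen_eqMixin (config R).
HB.instance Definition _ (R : realType) := gen_choiceMixin (config R).
HB.instance Definition _ (R : realType) := isPointed.Build (config R) (config0 R).

Definition config_gen (R : realType) (s : R) : set (set (config R)) :=
  [set (fun mu : config R => mu B) @^-1` E |
     B in [set B : set (R * R) | measurable B /\
             exists r : R, B `<=` `[0%R, s]%classic `*` `[0%R, r]%classic]
   & E in (measurable : set (set (\bar R)))].

Definition config_filtration (R : realType) (s : R) : set (set (config R)) :=
  <<s config_gen s >>.

Definition config_gen_all (R : realType) : set (set (config R)) :=
  \bigcup_(s in [set s : R | (0 <= s)%R]) @config_gen R s.

(* This is also the Borel sigma-algebra of the vague topology. *)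
HB.instance Definition _ (R : realType) :=
  Measurable.copy (config R) (g_sigma_algebraType (@config_gen_all R)).

Notation lebesgue2 R :=
  ((@lebesgue_measure R) \x (@lebesgue_measure R)).

(* Q is the law of a Poisson random measure on the quadrant with Lebesgue
   intensity. *)
Definition poisson_random_measure_law (R : realType)
    (Q : probability (config R) R) : Prop :=
  (forall B : set (R * R), measurable B -> B `<=` @quadrant R ->
     lebesgue2 R B < +oo ->
     forall k : nat,
       let lam := fine (lebesgue2 R B) in
       Q [set mu | mu B = k%:R%:E] =
         (lam ^+ k / k`!%:R * expR (- lam))%R%:E) /\
  (forall (n : nat) (B : 'I_n -> set (R * R)),
     (forall i, measurable (B i)) -> (forall i, B i `<=` @quadrant R) ->
     trivIset setT B ->
     forall E : 'I_n -> set (\bar R), (forall i, measurable (E i)) ->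
       Q [set mu | forall i, E i (mu (B i))] =
         \prod_(i < n) Q [set mu | E i (mu (B i))]).

Definition Omega (R : realType) : Type := (config R * config R)%type.

Definition filtration (R : realType) (s : R) : set (set (Omega R)) :=
  <<s [set B1 `*` B2 | B1 in @config_filtration R s
                     & B2 in @config_filtration R s] >>.

Definition stopping_time (R : realType) (tau : Omega R -> R) : Prop :=
  forall t : R, (0 <= t)%R -> filtration t [set w | (tau w <= t)%R].

Definition filtration_at (R : realType) (tau : Omega R -> R) :
    set (set (Omega R)) :=
  [set B | measurable B /\
     forall t : R, (0 <= t)%R -> filtration t (B `&` [set w | (tau w <= t)%R])].

Definition predictable_gen (R : realType) : set (set (R * Omega R)) :=
  [set [set 0%R] `*` B | B in @filtration R 0%R] `|`
  [set C | exists (u v : R) (B : set (Omega R)),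
     [/\ (0 <= u)%R, (u <= v)%R, filtration u B & C = `]u, v]%classic `*` B]].

(* Processes are indexed by all of R, but only their restriction to
   nonnegative times is meaningful. *)
Definition predictable (R : realType) (A : topologicalType)
    (alpha : R -> Omega R -> A) : Prop :=
  forall U : set A, borel A U ->
    <<s [set p : R * Omega R | (0 <= p.1)%R], @predictable_gen R >>
      [set p : R * Omega R | (0 <= p.1)%R /\ U (alpha p.1 p.2)].

Section concatenation.
Variables (R : realType) (t : R).

Let past : set (R * R) := `[0%R, t]%classic `*` `[0%R, +oo[%classic.
Let future : set (R * R) := `]t, +oo[%classic `*` `[0%R, +oo[%classic.

Let mpast : measurable past. Proof. exact: measurableX. Qed.
Let mfuture : measurable future. Proof. exact: measurableX. Qed.

Definition concat_measure (mu1 mu2 : config R) :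
    {measure set (R * R) -> \bar R} :=
  measure_add (mrestr mu1 mpast) (mrestr mu2 mfuture).

Lemma concat_measureE (mu1 mu2 : config R) B :
  concat_measure mu1 mu2 B = mu1 (B `&` past) + mu2 (B `&` future).
Proof.
exact: (measure_addE (mrestr mu1 mpast : {measure set _ -> \bar R})
                     (mrestr mu2 mfuture : {measure set _ -> \bar R})).
Qed.

Let mC : measurable (~` @quadrant R).
Proof. by apply: measurableC; exact: measurable_quadrant. Qed.

Let le_config (mu : config R) (B C : set (R * R)) : measurable B ->
  measurable C -> B `<=` C -> mu B <= mu C.
Proof. by move=> mB mC' BC; apply: le_measure => //; rewrite inE. Qed.

Lemma concat_supp (mu1 mu2 : config R) :
  concat_measure mu1 mu2 (~` @quadrant R) = 0.
Proof.
rewrite concat_measureE; apply/eqP; rewrite eq_le; apply/andP; split.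
  rewrite -[leRHS]adde0; apply: leeD.
    rewrite -(config_supp mu1); apply: le_config => //; exact: measurableI.
  rewrite -(config_supp mu2); apply: le_config => //; exact: measurableI.
by apply: adde_ge0; exact: measure_ge0.
Qed.

Lemma concat_int (mu1 mu2 : config R) B : measurable B ->
  concat_measure mu1 mu2 B = +oo \/
  exists k : nat, concat_measure mu1 mu2 B = k%:R%:E.
Proof.
move=> mB; rewrite concat_measureE.
have [->|[k1 ->]] := config_int mu1 (measurableI _ _ mB mpast).
  by left; rewrite addye// gt_eqF// (lt_le_trans (ltNyr 0)).
have [->|[k2 ->]] := config_int mu2 (measurableI _ _ mB mfuture).
  by left.
by right; exists (k1 + k2)%N; rewrite natrD EFinD.
Qed.

Lemma concat_lfin (mu1 mu2 : config R) (r : R) :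
  concat_measure mu1 mu2 (`[0%R, r]%classic `*` `[0%R, r]%classic) < +oo.
Proof.
have mB : measurable (`[0%R, r]%classic `*` `[0%R, r]%classic : set (R * R)).
  exact: measurableX.
rewrite concat_measureE; apply: lte_add_pinfty.
  by apply: le_lt_trans (config_lfin mu1 r); apply: le_config => //;
    exact: measurableI.
by apply: le_lt_trans (config_lfin mu2 r); apply: le_config => //;
  exact: measurableI.
Qed.

Definition concat (mu1 mu2 : config R) : config R :=
  @Config R (concat_measure mu1 mu2) (concat_supp mu1 mu2)
    (@concat_int mu1 mu2) (concat_lfin mu1 mu2).

End concatenation.

Section shift.
Variables (R : realType) (t : R).

Let translate (p : R * R) : R * R := ((t + p.1)%R, p.2).

Let mtranslate : measurable_fun setT translate.
Proof.
by apply/measurable_fun_pairP; split => /=;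
  [apply: measurable_funD => //; exact: measurable_fst|exact: measurable_snd].
Qed.

Definition translate_measure (mu : config R) :
    {measure set (R * R) -> \bar R}.
Proof.
unshelve refine (pushforward mu translate : {measure set (R * R) -> \bar R}).
exact: mtranslate.
Defined.

(* The restriction to the quadrant only matters for the meaningless t < 0: it
   makes the shift total. *)
Definition shift_measure (mu : config R) : {measure set (R * R) -> \bar R} :=
  mrestr (translate_measure mu) (@measurable_quadrant R).

Lemma shift_measureE (mu : config R) B :
  shift_measure mu B =
  mu [set p | (B `&` @quadrant R) ((t + p.1)%R, p.2)].
Proof. by []. Qed.

Lemma shift_supp (mu : config R) : shift_measure mu (~` @quadrant R) = 0.
Proof.
rewrite shift_measureE (_ : [set p | _] = set0) ?measure0//.
by apply/seteqP; split => q // -[].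
Qed.

Let mpre B : measurable B ->
  measurable [set p | (B `&` @quadrant R) ((t + p.1)%R, p.2)].
Proof.
move=> mB; have := mtranslate measurableT (measurableI _ _ mB (@measurable_quadrant R)).
by rewrite setTI.
Qed.

Lemma shift_int (mu : config R) B : measurable B ->
  shift_measure mu B = +oo \/ exists k : nat, shift_measure mu B = k%:R%:E.
Proof. by move=> mB; rewrite shift_measureE; apply: config_int; exact: mpre. Qed.

Lemma shift_lfin (mu : config R) (r : R) :
  shift_measure mu (`[0%R, r]%classic `*` `[0%R, r]%classic) < +oo.
Proof.
have mC : measurable (~` @quadrant R).
  by apply: measurableC; exact: measurable_quadrant.
have mB : measurable (`[0%R, r]%classic `*` `[0%R, r]%classic : set (R * R)).
  exact: measurableX.
pose r' := Num.max r (r - t)%R.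
have mB' : measurable (`[0%R, r']%classic `*` `[0%R, r']%classic : set (R * R)).
  exact: measurableX.
rewrite shift_measureE.
apply: (@le_lt_trans _ _
  (mu ((`[0%R, r']%classic `*` `[0%R, r']%classic) `|` ~` @quadrant R))).
  apply: le_measure; rewrite ?inE; [exact: mpre|exact: measurableU|].
  move=> [u z]/= [[]]; rewrite /= !in_itv/= => /andP[_ ur] /andP[z0 zr] _.
  have [u0|u0] := leP 0%R u; last first.
    right => -[] /= /andP[u0' _] _.
    by move: u0; rewrite ltNge (_ : (0 <= u)%R).
  left; split; rewrite /= ?z0 /r' le_max ?zr//.
  by have -> : (u <= r - t)%R; rewrite ?orbT// lerBrDl.
apply: (@le_lt_trans _ _ (mu (`[0%R, r']%classic `*` `[0%R, r']%classic)
                          + mu (~` @quadrant R))).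
  exact: measureU2.
by rewrite config_supp adde0 config_lfin.
Qed.

Definition shift_config (mu : config R) : config R :=
  @Config R (shift_measure mu) (shift_supp mu)
    (@shift_int mu) (@shift_lfin mu).

End shift.

Definition shift_control (R : realType) (A : Type) (alpha : R -> Omega R -> A)
    (t : R) (wbar : Omega R) : R -> Omega R -> A :=
  fun s w => alpha (t + s)%R
    (concat t wbar.1 (shift_config t w.1), concat t wbar.2 (shift_config t w.2)).

(* nat carries the discrete topology. *)
Definition cadlag (R : realType) (f : R -> nat) : Prop :=
  (forall t : R, (0 <= t)%R -> f u @[u --> t^'+] --> f t) /\
  (forall t : R, (0 < t)%R -> exists l : nat, f u @[u --> t^'-] --> l).

Definition left_limit (R : realType) (f : R -> nat) (t : R) : nat :=
  lim (f u @[u --> t^'-]).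

Section controlled_process.
Variables (R : realType) (A : topologicalType).
Variables (b d : nat -> A -> R) (p : nat -> nat -> A -> R).

Definition birth_interval (k n : nat) (a : A) : set R :=
  `[(b n a * \sum_(1 <= l < k) p n l a)%R,
    (b n a * \sum_(1 <= l < k.+1) p n l a)%R[%classic.

Definition birth_mark (n : nat) (a : A) (z : R) : \bar R :=
  \sum_(1 <= k <oo) (k%:R * \1_(birth_interval k n a) z)%:E.

Definition death_mark (n : nat) (a : A) (z : R) : \bar R :=
  (\1_(`[0%R, d n a[%classic : set R) z)%:E.

(* The integral equation, along one path; since its left-hand side is finite,
   so are both integrals. *)
Definition path_solves (x : nat) (alpha : R -> Omega R -> A) (w : Omega R)
    (f : R -> nat) : Prop :=
  forall s : R, (0 <= s)%R ->
    (f s)%:R%:E = x%:R%:E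
      + (\int[w.1]_(q in `]0%R, s]%classic `*` `[0%R, +oo[%classic)
           birth_mark (left_limit f q.1) (alpha q.1 w) q.2)
      - (\int[w.2]_(q in `]0%R, s]%classic `*` `[0%R, +oo[%classic)
           death_mark (left_limit f q.1) (alpha q.1 w) q.2).

(* The state space is option nat, None being the state infinity reached after
   an accumulation of jumps; almost every path avoids it. *)
Definition controlled_process (Q : probability (config R) R) (x : nat)
    (alpha : R -> Omega R -> A) (X : R -> Omega R -> option nat) : Prop :=
  (forall (s : R) (B : set (option nat)), (0 <= s)%R ->
     filtration s (X s @^-1` B)) /\
  {ae (Q \x Q), forall w, exists f : R -> nat,
     [/\ forall s : R, (0 <= s)%R -> X s w = Some (f s),
         cadlag f & path_solves x alpha w f]}.

End controlled_process.

(* A function on nat, extended by 0 to the null event of an accumulation. *)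
Definition extend0 (R : realType) (phi : nat -> R) (n : option nat) : \bar R :=
  if n is Some m then (phi m)%:E else 0.

(* Y is a version of the conditional expectation E[Z | G], for Z >= 0 and G a
   sub-sigma-algebra. *)
Definition cond_expectation d (T : measurableType d) (R : realType)
    (P : set T -> \bar R) (G : set (set T)) (Z Y : T -> \bar R) : Prop :=
  [/\ forall w, 0 <= Y w,
      measurable_wrt G Y
    & forall B, G B -> \int[P]_(w in B) Y w = \int[P]_(w in B) Z w].

(* Main.v *)
(* Let P be the law on Omega and let Phi(wbar, w) be the path equal to wbar up to
   time tau(wbar) and continued by the shift of w afterwards. The heart of the
   proof is the strong Markov property of the Poisson measures: Phi transports
   P \x P to P. For a fixed time this is the independence of Poisson counts on
   disjoint sets and the translation invariance of Lebesgue measure; for a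
   stopping time with values in a grid one sums over the values; in general one
   lets the mesh go to zero, the counts on sets that are clopen from the right in
   the time variable being eventually constant along the approximation.
   Since an event of F_tau depends on the path up to tau only (Galmarino),
   Y(wbar) = E[phi(X_s(Phi(wbar, .)))] is a version of the conditional
   expectation. Finally, along almost every path u |-> X_{tau + u}(Phi(wbar, .))
   solves the equation started at X_tau(wbar) and driven by the shifted control,
   and that equation has at most one integer-valued cadlag solution: two solutions
   that agree before T have the same left limits, hence the same integrals, up to
   T, and they are constant on a right neighbourhood of T. *)
Require Import Defs.
From mathcomp Require Import all_boot all_order all_algebra.
From mathcomp Require Import all_classical all_reals all_analysis.
From mathcomp Require Import measurable_realfun.
Import Order.TTheory GRing.Theory Num.Theory.
Import numFieldNormedType.Exports.
Local Open Scope classical_set_scope.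
Local Open Scope ring_scope.
Local Open Scope ereal_scope.

Set Implicit Arguments.
Unset Strict Implicit.
Unset Printing Implicit Defensive.

(** * Paths up to a given time *)

(** The sets with a good preimage form a sigma-algebra; that [f] maps [D1] into [D2] makes relative
    complements correspond. The domains matter for the predictable sigma-algebra, which lives on
    nonnegative times. *)
Lemma sigma_algebra_preimage (T1 T2 : Type) (D1 : set T1) (D2 : set T2)
    (f : T1 -> T2) (S : set (set T1)) (G : set (set T2)) :
  sigma_algebra D1 S -> (forall x, D1 x -> D2 (f x)) ->
  (forall B, G B -> S (D1 `&` f @^-1` B)) ->
  forall B, <<s D2, G >> B -> S (D1 `&` f @^-1` B).
Proof.
move=> [S0 SC SU] fD GS.
suff: <<s D2, G >> `<=` [set B | S (D1 `&` f @^-1` B)] by [].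
apply: smallest_sub => //=.
split => [|A SA|A SA] /=.
- by rewrite preimage_set0 setI0.
- rewrite (_ : _ `&` _ = D1 `\` (D1 `&` f @^-1` A)); first exact: SC.
  apply/seteqP; split => [x [Dx [_ nA]]|x [Dx nA]].
    by split => // -[].
  by split => //; split; [exact: fD|move=> Afx; exact: nA].
- by rewrite preimage_bigcup setI_bigcupr; exact: SU.
Qed.

Lemma sigma_algebra_preimageT (T1 T2 : Type) (f : T1 -> T2)
    (S : set (set T1)) (G : set (set T2)) :
  sigma_algebra setT S -> (forall B, G B -> S (f @^-1` B)) ->
  forall B, <<s G >> B -> S (f @^-1` B).
Proof.
move=> hS hG B /(@sigma_algebra_preimage _ _ setT setT f S G hS).
by rewrite setTI; apply => // C /hG; rewrite setTI.
Qed.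

Lemma sigma_algebraI T (S : set (set T)) : sigma_algebra setT S -> setI_closed S.
Proof.
move=> [S0 SC SU] A B SA SB.
have SC' C : S C -> S (~` C) by move=> /SC; rewrite setTD.
rewrite -[A]setCK -[B]setCK -setCU; apply: (SC').
rewrite -bigcup2E; by apply: SU => -[|[|n]] //=; exact: SC'.
Qed.

Lemma sigma_algebraC T (S : set (set T)) : sigma_algebra setT S ->
  forall A, S A -> S (~` A).
Proof. by case=> _ SC _ A /SC; rewrite setTD. Qed.

Lemma sigma_algebra_setT T (S : set (set T)) : sigma_algebra setT S -> S setT.
Proof. by case=> S0 /(_ _ S0) + _; rewrite setTD setC0. Qed.

Section configurations.
Variable R : realType.
Implicit Types (mu nu : config R) (B : set (R * R)) (s t r : R) (w : Omega R).

Definition box s r : set (R * R) := `[0%R, s]%classic `*` `[0%R, r]%classic.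

Lemma measurable_box s r : measurable (box s r).
Proof. exact: measurableX. Qed.

Lemma box_mono s s' r r' : (s <= s')%R -> (r <= r')%R -> box s r `<=` box s' r'.
Proof.
move=> ss' rr' [u z] /=; rewrite /box /= !in_itv /=.
move=> [/andP[-> us] /andP[-> zr]].
by rewrite (le_trans us ss') (le_trans zr rr').
Qed.

Lemma config_fin mu B s r : measurable B -> B `<=` box s r -> mu B < +oo.
Proof.
move=> mB Bsr; pose m := Num.max s r.
apply: le_lt_trans (config_lfin mu m).
apply: le_measure; rewrite ?inE //; first exact: measurable_box.
by apply: subset_trans Bsr _; apply: box_mono; rewrite le_max lexx ?orbT.
Qed.

Lemma config_nat mu B s r : measurable B -> B `<=` box s r ->
  exists k : nat, mu B = k%:R%:E.
Proof.
move=> mB Bsr; case: (config_int mu mB) => // muB.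
by move: (config_fin mu mB Bsr); rewrite muB ltxx.
Qed.

Lemma measurable_config_eval B s r : measurable B -> B `<=` box s r ->
  measurable_fun setT (fun mu => mu B).
Proof.
move=> mB Bsr _ E mE; rewrite setTI; apply: sub_sigma_algebra.
exists (Num.max 0%R s); first by rewrite /= le_max lexx.
exists B.
  split=> //; exists r; apply: subset_trans Bsr _.
  by apply: box_mono => //; rewrite le_max lexx orbT.
by exists E.
Qed.

Lemma sigma_algebra_config_filtration t :
  sigma_algebra setT (@config_filtration R t).
Proof. exact: smallest_sigma_algebra. Qed.

Lemma sigma_algebra_filtration t : sigma_algebra setT (@filtration R t).
Proof. exact: smallest_sigma_algebra. Qed.

Lemma sigma_algebra_measurable d (T : measurableType d) :
  sigma_algebra setT (@measurable d T).
Proof.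
by split=> [|A mA|F mF]; [exact: measurable0|rewrite setTD; exact: measurableC
  |exact: bigcup_measurable].
Qed.

Lemma config_filtration_measurable t (E : set (config R)) :
  (0 <= t)%R -> config_filtration t E -> measurable E.
Proof.
move=> t0; apply: smallest_sub; first exact: sigma_algebra_measurable.
by move=> C GC; apply: sub_sigma_algebra; exists t.
Qed.

Lemma filtration_measurable t (E : set (Omega R)) :
  (0 <= t)%R -> filtration t E -> measurable E.
Proof.
move=> t0; apply: smallest_sub; first exact: sigma_algebra_measurable.
move=> _ [B1 F1 [B2 F2 <-]].
by apply: measurableX; exact: (@config_filtration_measurable t).
Qed.

(* Weaker than equality of the restrictions, which would also constrain the junk
   values of the measures on nonmeasurable sets. *)
Definition agree t mu nu := forall B, measurable B ->
  (exists r, B `<=` box t r) -> mu B = nu B.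

Lemma agree_sym t mu nu : agree t mu nu -> agree t nu mu.
Proof. by move=> h B mB hB; rewrite h. Qed.

(** Events that fail to separate [mu] from [nu] form a sigma-algebra containing the generators: the
    easy half of Galmarino's test. *)
Lemma config_filtration_agree t (E : set (config R)) mu nu :
  config_filtration t E -> agree t mu nu -> E mu -> E nu.
Proof.
move=> FE a.
suff: config_filtration t `<=` [set E | E mu <-> E nu] by move=> /(_ _ FE)[].
apply: smallest_sub => [|_ [B [mB hB] [C mC <-]]] /=; last by rewrite a.
split => [//|A /= AE|F] /=.
  by split => -[_ h]; split => // Anu; exact/h/AE.
by move=> FE'; split => -[i _ Fi]; exists i => //; exact/FE'.
Qed.

Definition agree2 t w w' := agree t w.1 w'.1 /\ agree t w.2 w'.2.

Lemma agree2_sym t w w' : agree2 t w w' -> agree2 t w' w.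
Proof. by move=> [h1 h2]; split; exact: agree_sym. Qed.

Lemma filtration_agree t (E : set (Omega R)) w w' :
  filtration t E -> agree2 t w w' -> E w -> E w'.
Proof.
move=> FE a.
suff: filtration t `<=` [set E | E w <-> E w'] by move=> /(_ _ FE)[].
apply: smallest_sub => [|_ [B1 h1 [B2 h2 <-]]] /=.
  split => [//|A /= AE|F] /=.
    by split => -[_ h]; split => // Anu; exact/h/AE.
  by move=> FE'; split => -[i _ Fi]; exists i => //; exact/FE'.
have [a1 a2] := a.
split => -[e1 e2]; split.
- exact: (config_filtration_agree h1 a1).
- exact: (config_filtration_agree h2 a2).
- exact: (config_filtration_agree h1 (agree_sym a1)).
- exact: (config_filtration_agree h2 (agree_sym a2)).
Qed.

Definition past t : set (R * R) := `[0%R, t]%classic `*` `[0%R, +oo[%classic.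

(** The part of [B] after [t], seen from time [t]. The strict inequality at 0 matches [past t] being
    closed at [t]: a point at time exactly [t] counts as past. *)
Definition after t B : set (R * R) :=
  [set q | B ((t + q.1)%R, q.2)] `&` (`]0%R, +oo[%classic `*` `[0%R, +oo[%classic).

Lemma measurable_past t : measurable (past t).
Proof. exact: measurableX. Qed.

Lemma measurable_translate t :
  measurable_fun setT (fun q : R * R => ((t + q.1)%R, q.2)).
Proof.
apply/measurable_fun_pairP; split => /=.
  by apply: measurable_funD => //; exact: measurable_fst.
exact: measurable_snd.
Qed.

Lemma measurable_after t B : measurable B -> measurable (after t B).
Proof.
move=> mB; apply: measurableI; last exact: measurableX.
by rewrite -[X in measurable X]setTI; exact: measurable_translate.
Qed.

Lemma after_box t s r B : (0 <= t)%R ->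
  B `<=` box s r -> after t B `<=` box (s - t) r.
Proof.
move=> t0 Bsr [u z] [/= /Bsr]; rewrite /box /= !in_itv /= !andbT.
move=> [/andP[_ h1] ->] [/ltW -> _]; split => //.
by rewrite lerBrDl.
Qed.

(* The paper's mu (x)_t nu^t. *)
Definition graft t mu nu : config R := concat t mu (shift_config t nu).

(** By [0 <= t], the restriction to the quadrant in [shift_measure] is harmless: translated future
    points have positive time. *)
Lemma graftE t mu nu B : (0 <= t)%R ->
  graft t mu nu B = mu (B `&` past t) + nu (after t B).
Proof.
move=> t0; transitivity (concat_measure t mu (shift_config t nu) B) => //.
rewrite concat_measureE; congr (_ + _).
transitivity (shift_measure t nu (B `&` (`]t, +oo[ `*` `[0%R, +oo[))) => //.
rewrite shift_measureE; congr (nu _).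
apply/seteqP; split => -[u z] /=; rewrite /after /quadrant /= !in_itv /= !andbT.
  by move=> [[Bu [h z0]] _]; split => //; split => //; rewrite -ltrBlDl subrr in h.
move=> [Bu [u0 z0]]; split; last by split => //; rewrite addr_ge0 // ltW.
by split => //; split=> //; rewrite ltrDl.
Qed.

Lemma agree_graft t mu nu : (0 <= t)%R -> agree t mu (graft t mu nu).
Proof.
move=> t0 B mB [r Br]; rewrite graftE// (_ : after t B = set0).
  rewrite measure0 adde0; congr (mu _); apply/seteqP; split => // -[u z] h.
  split => //; have := Br _ h; rewrite /box /past /= !in_itv /=.
  by move=> [-> /andP[->]].
apply/seteqP; split => // q aq; have [+ _] := after_box t0 Br aq.
have [_ [+ _]] := aq; rewrite subrr /= !in_itv /= andbT => q0 /andP[_].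
by rewrite leNgt q0.
Qed.

Lemma measurable_graft t : (0 <= t)%R ->
  measurable_fun setT (fun q : config R * config R => graft t q.1 q.2).
Proof.
move=> t0; apply: (@measurability _ _ _ _ _ _ (@config_gen_all R)) => //.
move=> _ [_ [s s0 [B [mB [r Br]] [E mE <-]]] <-].
rewrite setTI.
have mg : measurable_fun setT (fun q : config R * config R =>
    q.1 (B `&` past t) + q.2 (after t B)).
  apply: emeasurable_funD.
    apply: (measurableT_comp (f := fun mu : config R => mu (B `&` past t))) => //.
    apply: (@measurable_config_eval _ s r) => //.
      by apply: measurableI => //; exact: measurable_past.
    by move=> q [/Br].
  apply: (measurableT_comp (f := fun mu : config R => mu (after t B))) => //.
  apply: (@measurable_config_eval _ (s - t) r); first exact: measurable_after.
  exact: after_box.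
have := mg measurableT _ mE; rewrite setTI.
by congr measurable; apply/seteqP; split => q /=; rewrite graftE.
Qed.

(** With the past frozen, a count up to [u] is a constant plus the count on [after t B], which only
    involves times up to [u - t]. *)
Lemma config_filtration_graft t u mu (E : set (config R)) :
  (0 <= t <= u)%R -> config_filtration u E ->
  config_filtration (u - t)%R (graft t mu @^-1` E).
Proof.
move=> /andP[t0 tu]; apply: sigma_algebra_preimageT.
  exact: sigma_algebra_config_filtration.
move=> _ [B [mB [r Br]] [C mC <-]].
apply: sub_sigma_algebra.
exists (after t B).
  split; first exact: measurable_after.
  by exists r; exact: after_box.
exists ((fun y => mu (B `&` past t) + y) @^-1` C).
  rewrite -[X in measurable X]setTI.
  by have : measurable_fun setT (fun y => mu (B `&` past t) + y);
    [exact: emeasurable_funD|exact].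
by apply/seteqP; split => nu /=; rewrite graftE.
Qed.

Definition graft2 t w w' : Omega R := (graft t w.1 w'.1, graft t w.2 w'.2).

Lemma agree2_graft2 t w w' : (0 <= t)%R -> agree2 t w (graft2 t w w').
Proof. by move=> t0; split; exact: agree_graft. Qed.

Lemma filtration_graft2 t u w (E : set (Omega R)) :
  (0 <= t <= u)%R -> filtration u E ->
  filtration (u - t)%R (graft2 t w @^-1` E).
Proof.
move=> tu; apply: sigma_algebra_preimageT.
  exact: sigma_algebra_filtration.
move=> _ [B1 F1 [B2 F2 <-]]; apply: sub_sigma_algebra.
exists (graft t w.1 @^-1` B1); first exact: config_filtration_graft.
by exists (graft t w.2 @^-1` B2); first exact: config_filtration_graft.
Qed.

Lemma measurable_graft2 t : (0 <= t)%R ->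
  measurable_fun setT (fun q : Omega R * Omega R => graft2 t q.1 q.2).
Proof.
move=> t0; apply/measurable_fun_pairP; split.
  have h : measurable_fun setT
      (fun q : (config R * config R) * (config R * config R) => (q.1.1, q.2.1)).
    apply/measurable_fun_pairP; split.
      exact: (measurableT_comp measurable_fst measurable_fst).
    exact: (measurableT_comp measurable_fst measurable_snd).
  exact: (measurableT_comp (measurable_graft t0) h).
have h : measurable_fun setT
    (fun q : (config R * config R) * (config R * config R) => (q.1.2, q.2.2)).
  apply/measurable_fun_pairP; split.
    exact: (measurableT_comp measurable_snd measurable_fst).
  exact: (measurableT_comp measurable_snd measurable_snd).
exact: (measurableT_comp (measurable_graft t0) h).
Qed.

(** Grafting the empty configuration erases all points after [t]. *)
Definition stop2 t w : Omega R := graft2 t w (config0 R, config0 R).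

Lemma config_filtration_stop t (E : set (config R)) : (0 <= t)%R ->
  measurable E -> config_filtration t ((graft t ^~ (config0 R)) @^-1` E).
Proof.
move=> t0; apply: sigma_algebra_preimageT.
  exact: sigma_algebra_config_filtration.
move=> _ [s s0 [B [mB [r Br]] [C mC <-]]].
apply: sub_sigma_algebra; exists (B `&` past t).
  split; first by apply: measurableI => //; exact: measurable_past.
  by exists r => q [/Br [_ ?] [? _]].
exists C => //; apply/seteqP; split => mu /=; rewrite graftE//=;
  by rewrite /mzero adde0.
Qed.

Lemma filtration_stop2 t (E : set (Omega R)) : (0 <= t)%R ->
  measurable E -> filtration t (stop2 t @^-1` E).
Proof.
move=> t0; rewrite [measurable]measurable_prod_measurableType.
apply: sigma_algebra_preimageT; first exact: sigma_algebra_filtration.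
move=> _ [B1 F1 [B2 F2 <-]]; apply: sub_sigma_algebra.
exists ((graft t ^~ (config0 R)) @^-1` B1); first exact: config_filtration_stop.
by exists ((graft t ^~ (config0 R)) @^-1` B2); first exact: config_filtration_stop.
Qed.

(* Converse of [filtration_agree]. *)
Lemma filtration_of_stop2 t (E : set (Omega R)) : (0 <= t)%R ->
  measurable E -> (forall w, E w <-> E (stop2 t w)) -> filtration t E.
Proof.
move=> t0 mE h; rewrite (_ : E = stop2 t @^-1` E); first exact: filtration_stop2.
by apply/seteqP; split => w; [exact: (h w).1|exact: (h w).2].
Qed.

End configurations.

(** * Generating the sigma-algebra of configurations by counts *)

Section generation.
Variable R : realType.
Implicit Types (mu nu : config R) (B : set (R * R)) (s t r : R) (w : Omega R).
Implicit Type D : set (set (R * R)).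

(** Arbitrary finite index types make intersections immediate, by summing the index types; the empty
    type gives [setT]. *)
Definition count_events D : set (set (config R)) :=
  [set E | exists (I : finType) (B : I -> set (R * R)) (k : I -> nat),
    (forall i, D (B i)) /\ E = [set mu : config R | forall i, mu (B i) = (k i)%:R%:E]].

Lemma count_events_setI D : setI_closed (count_events D).
Proof.
move=> _ _ [I [B [k [DB ->]]]] [J [C [l [DC ->]]]].
exists (I + J)%type, (fun x => match x with inl i => B i | inr j => C j end),
  (fun x => match x with inl i => k i | inr j => l j end).
split; first by case.
apply/seteqP; split => mu /=; first by move=> [h1 h2] [].
by move=> h; split => i; [exact: (h (inl i))|exact: (h (inr i))].
Qed.

Lemma count_events_setT D : count_events D setT.
Proof. by exists void, (fun=> set0), (fun=> 0%N); split => [[]|];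
  apply/seteqP; split => // mu _ []. Qed.

Lemma measurable_nat_valued d (T : measurableType d) (f : T -> \bar R) :
  (forall x, exists k : nat, f x = k%:R%:E) ->
  (forall k : nat, measurable [set x | f x = k%:R%:E]) ->
  measurable_fun setT f.
Proof.
move=> fnat fm _ E mE; rewrite setTI.
rewrite (_ : _ @^-1` _ =
  \bigcup_(k in [set k : nat | E k%:R%:E]) [set x | f x = k%:R%:E]).
  by apply: bigcup_measurable => k _; exact: fm.
apply/seteqP; split => x /=; last by move=> [k Ek /= ->].
by have [k fx] := fnat x; rewrite fx => Ek; exists k.
Qed.

Definition bounded_events : set (set (R * R)) :=
  [set B | measurable B /\ exists r, B `<=` box r r].

Lemma box_bounded B s r : B `<=` box s r -> exists r, B `<=` box r r.
Proof.
move=> h; exists (Num.max s r); apply: subset_trans h _.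
by apply: box_mono; rewrite le_max lexx ?orbT.
Qed.

Lemma measurable_count D B k : D `<=` bounded_events -> D B ->
  measurable [set mu : config R | mu B = k%:R%:E].
Proof.
move=> Db /Db [mB [r Br]].
have := measurable_config_eval mB Br measurableT (emeasurable_set1 k%:R%:E).
by rewrite setTI.
Qed.

Lemma count_events_measurable D : D `<=` bounded_events ->
  count_events D `<=` measurable.
Proof.
move=> Db _ [I [B [k [DB ->]]]].
rewrite (_ : [set mu : config R | _] =
   \bigcap_(i in [set: I]) [set mu : config R | mu (B i) = (k i)%:R%:E]).
  by apply: fin_bigcap_measurable => // i _; exact: measurable_count (DB i).
by apply/seteqP; split => mu /= h i; [move=> _|]; exact: h.
Qed.

Lemma count_events_eval D B : D `<=` bounded_events -> D B ->
  measurable_fun setT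
    (fun mu : g_sigma_algebraType (count_events D) => (mu : config R) B).
Proof.
move=> Db DB; apply: measurable_nat_valued => [mu|k].
  by have [mB [r Br]] := Db _ DB; exact: config_nat mB Br.
apply: sub_sigma_algebra; exists unit, (fun=> B), (fun=> k); split => //.
by apply/seteqP; split => mu //= /(_ tt).
Qed.

(** Counts of bounded sets generate the sigma-algebra by construction, so it suffices to recover all
    of them from the counts on [D]. *)
Lemma config_measurableE D : D `<=` bounded_events ->
  (forall B, bounded_events B -> measurable_fun setT
    (fun mu : g_sigma_algebraType (count_events D) => (mu : config R) B)) ->
  @measurable _ (config R) = <<s count_events D >>.
Proof.
move=> Db mD; apply/seteqP; split; last first.
  apply: smallest_sub; first exact: sigma_algebra_measurable.
  exact: count_events_measurable.
apply: smallest_sub; first exact: smallest_sigma_algebra.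
move=> _ [s s0 [B [mB [r Br]] [E mE <-]]].
have [r' Br'] := box_bounded Br.
have := mD B (conj mB (ex_intro _ r' Br')) measurableT _ mE.
by rewrite setTI.
Qed.

(** On each such set the count of a graft at [t] is a count of only one of its two parts. *)
Definition split_events t : set (set (R * R)) :=
  bounded_events `&` [set B | B `<=` past t \/ B `&` past t = set0].

Lemma measurableE_split t :
  @measurable _ (config R) = <<s count_events (split_events t) >>.
Proof.
have sb : split_events t `<=` bounded_events by move=> B [].
apply: config_measurableE => // B [mB [r Br]].
rewrite (_ : (fun mu : g_sigma_algebraType _ => _) =
  (fun mu : g_sigma_algebraType (count_events (split_events t)) =>
    (mu : config R) (B `&` past t) + (mu : config R) (B `\` past t))).
  apply: emeasurable_funD.
    apply: count_events_eval => //; split; last by left; exact: subIsetr.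
    split; first by apply: measurableI => //; exact: measurable_past.
    by exists r => q [/Br].
  apply: count_events_eval => //; split.
    split; first by apply: measurableD => //; exact: measurable_past.
    by exists r => q [/Br].
  by right; apply/seteqP; split => // q [[_ nq] /nq].
apply/funext => mu; rewrite -measureU.
- by rewrite setUIDK.
- by apply: measurableI => //; exact: measurable_past.
- by apply: measurableD => //; exact: measurable_past.
- by apply/seteqP; split => // q [[_ ?] [_ /(_ _)]].
Qed.

(* On such a set, counts are right-continuous in the shift parameter. *)
Definition right_clopen B := forall u z : R, exists2 e : R, (0 < e)%R &
  forall h, (0 <= h < e)%R -> B ((u + h)%R, z) <-> B (u, z).

Definition rc_events : set (set (R * R)) := bounded_events `&` right_clopen.

Lemma right_clopen_itv (a : R) (C : set R) : right_clopen (`[a, +oo[ `*` C).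
Proof.
move=> u z; have [au|ua] := leP a u.
  exists 1%R => // h /andP[h0 _]; rewrite /= !in_itv /= !andbT.
  by rewrite au (le_trans au)// lerDl.
exists (a - u)%R; first by rewrite subr_gt0.
move=> h /andP[_]; rewrite ltrBrDl => hlt; rewrite /= !in_itv /= !andbT.
by rewrite !leNgt ua hlt.
Qed.

Lemma right_clopenI B B' : right_clopen B -> right_clopen B' ->
  right_clopen (B `&` B').
Proof.
move=> h h' u z; have [e e0 he] := h u z; have [e' e'0 he'] := h' u z.
exists (Num.min e e'); first by rewrite lt_min e0.
move=> x; rewrite lt_min => /and3P[x0 xe xe'].
have [h1 h2] : B ((u + x)%R, z) <-> B (u, z) by apply: he; rewrite x0.
have [h1' h2'] : B' ((u + x)%R, z) <-> B' (u, z) by apply: he'; rewrite x0.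
by split => -[? ?]; split; auto.
Qed.

Lemma right_clopenC B : right_clopen B -> right_clopen (~` B).
Proof.
move=> h u z; have [e e0 he] := h u z; exists e => // x /he xB.
by split => nB /xB.
Qed.

(** Half-open in time, so that it is right-clopen, which [box] in general is not. *)
Definition corner (n : nat) : set (R * R) :=
  `[0%R, n%:R[%classic `*` `[0%R, n%:R[%classic.

(** A pi-system of right-clopen sets that generates the Borel sets of the plane. *)
Definition ray_events : set (set (R * R)) :=
  [set `[x, +oo[%classic `*` C | x in [set: R] & C in @measurable _ R].

Lemma ray_events_setI : setI_closed ray_events.
Proof.
move=> _ _ [x _ [C mC <-]] [y _ [C' mC' <-]].
exists (Num.max x y) => //; exists (C `&` C'); first exact: measurableI.
apply/seteqP; split => -[u z] /=; rewrite !in_itv /= !andbT ge_max.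
  by move=> [/andP[-> ->] []].
by move=> [[-> ?] [-> ?]].
Qed.

Lemma measurable_ray_events : @measurable _ (R * R)%type = <<s ray_events >>.
Proof.
apply/seteqP; split; last first.
  apply: smallest_sub; first exact: sigma_algebra_measurable.
  by move=> _ [x _ [C mC <-]]; exact: measurableX.
rewrite measurable_prod_measurableType.
apply: smallest_sub; first exact: smallest_sigma_algebra.
move=> _ [A mA [C mC <-]].
have sS := smallest_sigma_algebra setT ray_events.
(* A strip over all times is not a ray event but is exhausted by rays starting at [- n]. Complements
   of products are taken inside it below. *)
have TC : <<s ray_events >> (setT `*` C).
  rewrite (_ : _ `*` _ = \bigcup_n (`[(- n%:R : R)%R, +oo[%classic `*` C)).
    case: sS => _ _; apply => n; apply: sub_sigma_algebra.
    by exists (- n%:R)%R => //; exists C.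
  apply/seteqP; split => -[u z] /=; last by move=> [n _ [_ ?]].
  move=> [_ Cz]; exists (Num.truncn `|u|).+1 => //; split => //=.
  rewrite in_itv /= andbT lerNl; apply: le_trans (ltW (truncnS_gt `|u|)).
  by rewrite ler_normr lexx orbT.
have : (@RGenCInfty.G R).-sigma.-measurable A by rewrite -RGenCInfty.measurableE.
suff : <<s @RGenCInfty.G R >> `<=` [set A | <<s ray_events >> (A `*` C)] by exact.
apply: smallest_sub.
  split => [|B hB|F hF] /=.
  - by rewrite set0X; case: sS.
  - rewrite (_ : _ `*` _ = (setT `*` C) `&` ~` (B `*` C)).
      by apply: (sigma_algebraI sS TC); exact: (sigma_algebraC sS).
    apply/seteqP; split => -[u z] /=; first by move=> [[_ nB] ?]; split => // -[].
    by move=> [[_ Cz] nB]; split => //; split => // Bu; exact: nB.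
  - by rewrite setX_bigcupl; case: sS => _ _; exact.
move=> _ [x ->]; apply: sub_sigma_algebra.
by exists x => //; exists C.
Qed.

Lemma corner_bounded n : bounded_events (corner n).
Proof.
split; first exact: measurableX.
exists n%:R => -[u z]; rewrite /corner /box /= !in_itv /=.
by move=> [/andP[-> /ltW ->] /andP[-> /ltW ->]].
Qed.

Lemma right_clopen_corner n : right_clopen (corner n).
Proof.
rewrite (_ : corner n = (`[0%R, +oo[ `*` `[0%R, n%:R[)
    `&` ~` (`[n%:R, +oo[ `*` setT)).
  apply: right_clopenI; first exact: right_clopen_itv.
  by apply: right_clopenC; exact: right_clopen_itv.
apply/seteqP; split => -[u z]; rewrite /corner /= !in_itv /= !andbT.
  by move=> [/andP[-> un] ->]; split => //; rewrite leNgt un => -[].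
move=> [[-> ->] h]; split => //; rewrite ltNge /=.
by apply/negP => h'; apply: h.
Qed.

(** A Dynkin argument: the sets whose truncations by all corners have measurable counts form a
    lambda-system containing the rays. Truncation keeps the counts finite, so that they can be
    subtracted. *)
Lemma measurableE_rc : @measurable _ (config R) = <<s count_events rc_events >>.
Proof.
have sb : rc_events `<=` bounded_events by move=> B [].
apply: config_measurableE => // B [mB [r Br]].
pose H := [set B : set (R * R) | measurable B /\ forall n, measurable_fun setT
  (fun mu : g_sigma_algebraType (count_events rc_events) =>
     (mu : config R) (B `&` corner n))].
have fin (mu : config R) C n : measurable C -> mu (C `&` corner n) \is a fin_num.
  move=> mC; rewrite ge0_fin_numE//.
  have [mc [r' cr]] := corner_bounded n.
  by apply: (@config_fin _ mu _ r' r'); [exact: measurableI|move=> q [_ /cr]].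
suff HB : H B.
  (* The integer [(Num.truncn r).+1] exceeds [r], so this corner contains all of [B]. *)
  have Bn : B `&` corner (Num.truncn r).+1 = B.
    apply: setIidl => -[u z] /Br; rewrite /corner /box /= !in_itv /=.
    by move=> [/andP[-> ur] /andP[-> zr]];
      split; [move: ur|move: zr] => /le_lt_trans; apply; exact: truncnS_gt.
  by have [_ /(_ (Num.truncn r).+1)] := HB; rewrite Bn.
move: mB; rewrite measurable_ray_events.
apply: lambda_system_subset => //; first exact: ray_events_setI.
  split=> //.
  - split => // n; rewrite setTI; apply: count_events_eval => //.
    by split; [exact: corner_bounded|exact: right_clopen_corner].
  - move=> C C' C'C [mC hC] [mC' hC']; split; first exact: measurableD.
    move=> n; rewrite (_ : (fun mu : g_sigma_algebraType _ => _) =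
      (fun mu : g_sigma_algebraType (count_events rc_events) =>
      (mu : config R) (C `&` corner n) - (mu : config R) (C' `&` corner n))).
      exact: emeasurable_funB.
    apply/funext => mu.
    have mc : measurable (corner n) by have [] := corner_bounded n.
    rewrite (_ : (C `\` C') `&` corner n =
        (C `&` corner n) `\` (C' `&` corner n)); last first.
      apply/seteqP; split => q [[Cq h] h'].
        by split => // -[/h].
      by split => //; split => // C'q; exact: h'.
    rewrite measureD//; first 1 last.
    + exact: measurableI.
    + exact: measurableI.
    + by rewrite -ge0_fin_numE//; exact: fin.
    congr (_ - mu _); apply: setIidr => q [? ?]; split => //.
    exact: C'C.
  - move=> F ndF HF; have mF n : measurable (F n) by have [] := HF n.
    split; first exact: bigcup_measurable.
    move=> n; have mc : measurable (corner n) by have [] := corner_bounded n.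
    apply: (emeasurable_fun_cvg (fun m (mu : g_sigma_algebraType _) =>
      (mu : config R) (F m `&` corner n))).
      by move=> m; have [_] := HF m; exact.
    move=> mu _; rewrite setI_bigcupl.
    apply: nondecreasing_cvg_mu.
    + by move=> m; exact: measurableI.
    + by apply: bigcup_measurable => m _; exact: measurableI.
    + move=> m m' mm'; apply/subsetPset; apply: setSI; exact/subsetPset/ndF.
move=> _ [x _ [C mC <-]]; split; first exact: measurableX.
move=> n; apply: count_events_eval => //; split.
  have [mc [r' cr]] := corner_bounded n.
  split; first by apply: measurableI => //; exact: measurableX.
  by exists r' => q [_ /cr].
apply: right_clopenI; first exact: right_clopen_itv.
exact: right_clopen_corner.
Qed.

End generation.

(** * Reduction to disjoint families *)

Section atoms.
Variable R : realType.
Implicit Type D : set (set (R * R)).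

(** A cell of the Venn diagram of the family. The cell of the empty [S] is forced to be empty, since
    otherwise it would be the unbounded complement of the union. *)
Definition atom (I : finType) (B : I -> set (R * R)) (S : {set I}) : set (R * R) :=
  [set q | S != finset.set0 /\ forall i, (i \in S) <-> B i q].

Lemma atom_trivIset (I : finType) (B : I -> set (R * R)) :
  trivIset setT (atom B).
Proof.
move=> S S' _ _ [q [[_ h] [_ h']]]; apply/setP => i.
by apply/idP/idP => [/h /h'|/h' /h].
Qed.

(** As [D] may lack the whole space, the construction starts from one [B i0] with [i0] in [S], then
    intersects with or subtracts the sets one by one. *)
Lemma atom_closed D (I : finType) (B : I -> set (R * R)) (S : {set I}) :
  D set0 -> setI_closed D -> setD_closed D -> (forall i, D (B i)) -> D (atom B S).
Proof.
move=> D0 DI DD DB; have [->|/set0Pn [i0 i0S]] := eqVneq S finset.set0.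
  rewrite (_ : atom _ _ = set0)//; apply/seteqP; split => // q [].
  by rewrite eqxx.
pose X (s : seq I) := [set q | B i0 q /\ forall i, i \in s -> (i \in S) <-> B i q].
have DX s : D (X s).
  elim: s => [|i s IHs].
    by rewrite (_ : X _ = B i0)//; apply/seteqP; split => q //; case.
  have [iS|iS] := boolP (i \in S).
    rewrite (_ : X _ = X s `&` B i); first exact: DI.
    apply/seteqP; split => q.
      move=> [Bq h]; split; last by apply/h => //; rewrite mem_head.
      by split => // j js; apply: h; rewrite inE js orbT.
    move=> [[Bq h] Biq]; split => // j; rewrite inE => /predU1P[->|/h//].
    by split.
  rewrite (_ : X _ = X s `\` B i); first exact: DD.
  apply/seteqP; split => q.
    move=> [Bq h]; split; last by move=> /h; rewrite mem_head (negbTE iS) => /(_ isT).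
    by split => // j js; apply: h; rewrite inE js orbT.
  move=> [[Bq h] Biq]; split => // j; rewrite inE => /predU1P[->|/h//].
  by split => //; rewrite (negbTE iS).
rewrite (_ : atom _ _ = X (enum I)); first exact: DX.
apply/seteqP; split => q [].
  by move=> _ h; split; [exact/h|move=> i _].
move=> _ h; split; first by apply/set0Pn; exists i0.
by move=> i; apply: h; rewrite mem_enum.
Qed.

Lemma atomsE (mu : config R) (I : finType) (B : I -> set (R * R)) i :
  (forall j, measurable (B j)) ->
  mu (B i) = (\sum_(S \in [set S : {set I} | i \in S]) mu (atom B S))%R.
Proof.
move=> mB; rewrite -measure_fin_bigcup//.
- congr (mu _); apply/seteqP; split => q.
    move=> Bq; exists [set j | `[< B j q >]]%SET.
      by rewrite /= inE; apply/asboolP.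
    split; first by apply/set0Pn; exists i; rewrite inE; apply/asboolP.
    by move=> j; rewrite inE; split => /asboolP.
  by move=> [S /= iS [_ /(_ i)]] [+ _]; exact.
- exact: finite_finset.
- exact: sub_trivIset (@atom_trivIset I B).
- move=> S _; apply: (atom_closed (D := measurable)) => //.
  + exact: measurableI.
  + exact: measurableD.
Qed.

(* Decompose a finite family along the atoms it generates: the counts on the
   family are determined by the counts on the atoms, which are disjoint. *)
Lemma count_events_disjoint D (m1 m2 : {measure set (config R) -> \bar R}) :
  D `<=` bounded_events (R := R) -> D set0 -> setI_closed D -> setD_closed D ->
  (forall (I : finType) (B : I -> set (R * R)) (k : I -> nat),
    (forall i, D (B i)) -> trivIset setT B ->
    m1 [set mu | forall i, mu (B i) = (k i)%:R%:E] =
    m2 [set mu | forall i, mu (B i) = (k i)%:R%:E]) ->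
  forall E, count_events D E -> m1 E = m2 E.
Proof.
move=> Db D0 DI DD m12 _ [I [B [k [DB ->]]]].
(* The cell of a nonempty [S] lies inside some [B i], so no cell count exceeds [K] on the event, and
   finitely many assignments of cell counts suffice. *)
pose K := (\max_i k i)%N.
pose ev (m : {ffun {set I} -> 'I_K.+1}) :=
  [set mu : config R | forall S, mu (atom B S) = (m S)%:R%:E].
(* The assignments whose cell counts add up to the prescribed counts; the event is the disjoint
   union of [ev m] over them. *)
pose good := [set m : {ffun {set I} -> 'I_K.+1} |
  forall i, (\sum_(S \in [set S : {set I} | i \in S]) ((m S : nat)%:R : R)%:E)%R
            = (k i)%:R%:E].
have Datom S : D (atom B S) by exact: atom_closed.
have mB j : measurable (B j) by have [] := Db _ (DB j).
have -> : [set mu : config R | forall i, mu (B i) = (k i)%:R%:E] =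
    \bigcup_(m in good) ev m.
  apply/seteqP; split => mu.
    move=> /= h.
    have hS S : exists j : 'I_K.+1, mu (atom B S) = (j : nat)%:R%:E.
      have [mS [r Sr]] := Db _ (Datom S).
      have [j hj] := config_nat mu mS Sr.
      suff jK : (j < K.+1)%N by exists (Ordinal jK).
      have [S0|/set0Pn [i iS]] := eqVneq S finset.set0.
        rewrite (_ : j = 0%N)//; apply/eqP; rewrite -(eqr_nat R) -eqe -hj S0.
        rewrite (_ : atom _ _ = set0) ?measure0// -subset0 => q [].
        by rewrite eqxx.
      rewrite ltnS (leq_trans _ (leq_bigmax i))//.
      rewrite -(ler_nat R) -lee_fin -hj -h.
      apply: le_measure; rewrite ?inE//.
      by move=> q [_ /(_ i)] [+ _]; exact.
    have [m hm] := choice hS.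
    exists [ffun S => m S] => [i|S]; last by rewrite ffunE.
    rewrite -h (atomsE mu i mB); apply: eq_fsbigr => S _.
    by rewrite ffunE hm.
  move=> [m gm em] i /=; rewrite (atomsE mu i mB) -gm.
  by apply: eq_fsbigr => S _; exact: em.
have mev m : measurable (ev m).
  by apply: (count_events_measurable Db); exists {set I}, (atom B), (fun S => m S : nat).
have tev : trivIset good ev.
  move=> m m' _ _ [mu [h h']]; apply/ffunP => S; apply/val_inj/eqP.
  by rewrite -(eqr_nat R) -eqe -h -h'.
rewrite !measure_fin_bigcup//; [|exact: finite_finset..].
apply: eq_fsbigr => m _; apply: (m12 _ _ (fun S => m S : nat)) => //.
exact: atom_trivIset.
Qed.

End atoms.

(** * Translation invariance of Lebesgue measure *)

Section translation.
Variables (R : realType) (t : R).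

(** Provides the pushforward as a bundled measure known through its values, the form in which the
    uniqueness theorems are applied. *)
Lemma pushforward_measure d d' (T1 : measurableType d) (T2 : measurableType d')
    (m : {measure set T1 -> \bar R}) (f : T1 -> T2) : measurable_fun setT f ->
  exists m' : {measure set T2 -> \bar R}, forall A, m' A = m (f @^-1` A).
Proof.
move=> mf; unshelve eexists.
  by unshelve refine (pushforward m f : {measure set _ -> \bar _}).
by [].
Qed.

(** Lebesgue measure is determined by the lengths of half-open intervals, and translation preserves
    these. *)
Lemma lebesgue_measure_translate (A : set R) : measurable A ->
  lebesgue_measure [set u | A (t + u)%R] = lebesgue_measure A :> \bar R.
Proof.
have mt : measurable_fun setT (fun u : R => (t + u)%R).
  exact: measurable_funD.
have [m hm] := @pushforward_measure _ _ _ (measurableTypeR R) (@lebesgue_measure R) _ mt.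
move=> mA; rewrite [RHS](@lebesgue_measure_unique _ m)// => _ [[a b] _ <-].
rewrite hm (_ : _ @^-1` _ = `](a - t)%R, (b - t)%R]%classic).
  rewrite [LHS]lebesgue_measure_itv [RHS]lebesgue_measure_itv /= !lte_fin.
  by rewrite ltrD2r -!EFinB opprB addrA subrK.
by apply/seteqP; split => u; rewrite /= !in_itv /= ltrBlDl lerBrDl.
Qed.

Lemma lebesgue2_translate (B : set (R * R)) : measurable B ->
  lebesgue2 R [set q | B ((t + q.1)%R, q.2)] = lebesgue2 R B.
Proof.
move=> mB.
have mt : measurable_fun setT
  (fun q : measurableTypeR R * measurableTypeR R =>
     ((t + q.1)%R, q.2) : measurableTypeR R * measurableTypeR R).
  exact: (@measurable_translate R t).
have [m hm] := @pushforward_measure _ _ _ _ (lebesgue2 R) _ mt.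
rewrite [RHS](@product_measure_unique _ _ _ _ _ _ _ m) ?hm// => A C mA mC.
rewrite hm (_ : _ @^-1` _ = [set u | A (t + u)%R] `*` C)//.
transitivity (lebesgue_measure [set u : R | A (t + u)%R] * lebesgue_measure C);
  last by congr (_ * _); exact: lebesgue_measure_translate.
apply: product_measure1E => //; rewrite -[X in measurable X]setTI.
by have : measurable_fun setT (fun u : R => (t + u)%R);
  [exact: measurable_funD|exact].
Qed.

Lemma lebesgue2_box_lty (B : set (R * R)) s r : measurable B ->
  B `<=` box s r -> lebesgue2 R B < +oo.
Proof.
move=> mB Bsr; apply: (@le_lt_trans _ _ (lebesgue2 R (box s r))).
  by apply: le_measure; rewrite ?inE//; exact: measurable_box.
rewrite [ltLHS]product_measure1E// [X in X * _]lebesgue_measure_itv.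
rewrite [X in _ * X]lebesgue_measure_itv /=.
by do 2!case: ifPn => _; rewrite -?EFinB -?EFinM ?mul0e ?mule0 ?ltry.
Qed.
End translation.

(** * Markov property at a fixed time *)

Section poisson.
Variables (R : realType) (Q : probability (config R) R).
Hypothesis hQ : poisson_random_measure_law Q.
Implicit Types (mu nu : config R) (B : set (R * R)) (s t r : R) (w : Omega R).

Lemma poisson_indep (I : finType) (B : I -> set (R * R)) (E : I -> set (\bar R)) :
  (forall i, measurable (B i)) -> (forall i, B i `<=` @quadrant R) ->
  trivIset setT B -> (forall i, measurable (E i)) ->
  Q [set mu | forall i, E i (mu (B i))] = \prod_(i : I) Q [set mu | E i (mu (B i))].
Proof.
move=> mB Bq tB mE; have [_ ind] := hQ.
have E0 : [set mu : config R | forall i, E i (mu (B i))] =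
    [set mu : config R | forall j : 'I_#|I|, E (enum_val j) (mu (B (enum_val j)))].
  apply/seteqP; split => mu /= h i; first exact: h.
  by have := h (enum_rank i); rewrite enum_rankK.
transitivity (\prod_(j < #|I|) Q [set mu | E (enum_val j) (mu (B (enum_val j)))]).
  rewrite -(ind #|I| (fun i => B (enum_val i)) _ _ _ (fun i => E (enum_val i)))//.
    by congr (Q _); exact: E0.
   by move=> i j _ _ /(tB _ _ Logic.I Logic.I) /enum_val_inj.
by rewrite [RHS](reindex (@enum_val I I)) //; exact/onW_bij/enum_val_bij.
Qed.

Lemma box_quadrant s r : box s r `<=` @quadrant R.
Proof.
by move=> -[u z]; rewrite /box /quadrant /= !in_itv /= !andbT => -[/andP[-> _] /andP[-> _]].
Qed.

Lemma after_translate t s r B : B `<=` box s r -> B `&` past t = set0 ->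
  after t B = [set q | B ((t + q.1)%R, q.2)].
Proof.
move=> Br B0; apply: setIidl => -[u z] /= Bq.
have := Br _ Bq; rewrite /box /= !in_itv /= !andbT => -[/andP[h _] /andP[h' _]].
split => //; rewrite ltNge; apply/negP => u0.
have : set0 ((t + u)%R, z); last by [].
rewrite -B0; split => //; rewrite /past /= !in_itv /= andbT; split => //.
by rewrite h gerDl.
Qed.

(** Both counts are Poisson, with equal means by translation invariance. *)
Lemma poisson_after t B (k : nat) : bounded_events B -> B `&` past t = set0 ->
  Q [set mu | mu (after t B) = k%:R%:E] = Q [set mu | mu B = k%:R%:E].
Proof.
move=> [mB [r Br]] B0.
have mA := measurable_after t mB.
have leb : lebesgue2 R (after t B) = lebesgue2 R B.
  by rewrite (after_translate Br B0) lebesgue2_translate.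
have Bfin : lebesgue2 R B < +oo by apply: lebesgue2_box_lty Br.
have [pois _] := hQ.
have Aq : after t B `<=` @quadrant R.
  by move=> q [_ []]; rewrite /quadrant /= !in_itv /= !andbT => /ltW.
have Bq : B `<=` @quadrant R by apply: subset_trans Br _; exact: box_quadrant.
have Afin : lebesgue2 R (after t B) < +oo by rewrite leb.
transitivity ((fine (lebesgue2 R (after t B)) ^+ k / k`!%:R *
  expR (- fine (lebesgue2 R (after t B))))%R%:E); first exact: pois.
by rewrite leb; symmetry; exact: pois.
Qed.

Lemma trivIset_pointwise_sub T (I : Type) (F : I -> set T) (G : I -> set T) :
  (forall i, F i `<=` G i) -> trivIset setT G -> trivIset setT F.
Proof.
move=> FG tG i j _ _ [x [Fi Fj]]; apply: tG => //.
by exists x; split; exact: FG.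
Qed.

(** Each [B i] lies on one side of [t], so the event is a product of an event on [q.1] and one on
    [q.2]. Independence factorises both, and the factors recombine into the law under [Q]. *)
Lemma graft_law_disjoint t (I : finType) (B : I -> set (R * R)) (k : I -> nat) :
  (0 <= t)%R -> (forall i, split_events t (B i)) -> trivIset setT B ->
  (Q \x Q) [set q | forall i, graft t q.1 q.2 (B i) = (k i)%:R%:E] =
  Q [set mu | forall i, mu (B i) = (k i)%:R%:E].
Proof.
move=> t0 DB tB.
have mB i : measurable (B i) by have [[]] := DB i.
have Bq i : B i `<=` @quadrant R.
  by have [[_ [r Br]] _] := DB i; apply: subset_trans Br _; exact: box_quadrant.
(* In each coordinate, the indices belonging to the other side are padded with the empty set and the
   full event, which contribute a factor 1. *)
pose p i := `[< B i `<=` past t >].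
pose B1 i := if p i then B i else set0.
pose B2 i := if p i then set0 else after t (B i).
pose E1 i := if p i then [set (k i)%:R%:E : \bar R] else setT.
pose E2 i := if p i then setT else [set (k i)%:R%:E : \bar R].
have mE1 i : measurable (E1 i) by rewrite /E1; case: ifP.
have mE2 i : measurable (E2 i) by rewrite /E2; case: ifP.
have mB1 i : measurable (B1 i) by rewrite /B1; case: ifP.
have mB2 i : measurable (B2 i).
  by rewrite /B2; case: ifP => // _; exact: measurable_after.
have mev (C : I -> set (R * R)) (E : I -> set (\bar R)) :
    (forall i, measurable (E i)) ->
    (forall i, bounded_events (C i)) ->
    measurable [set mu : config R | forall i, E i (mu (C i))].
  move=> mE bC.
  rewrite (_ : [set mu : config R | _] =
     \bigcap_(i in [set: I]) [set mu : config R | E i (mu (C i))]).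
    apply: fin_bigcap_measurable => // i _; have [mC [r Cr]] := bC i.
    by have := measurable_config_eval mC Cr measurableT (mE i); rewrite setTI.
  by apply/seteqP; split => mu /= h i; [move=> _|]; exact: h.
have b0 : bounded_events (set0 : set (R * R)) by split => //; exists 0%R.
have npast i : p i = false -> B i `&` past t = set0.
  by move=> /asboolP np; have [_ []] := DB i.
have bB1 i : bounded_events (B1 i).
  by rewrite /B1; case: ifP => // _; have [] := DB i.
have bB2 i : bounded_events (B2 i).
  rewrite /B2; case: ifP => // _; split; first exact: measurable_after.
  have [[_ [r Br]] _] := DB i.
  by apply: (@box_bounded _ _ (r - t)%R r); exact: after_box.
rewrite (_ : [set q | _] = [set mu : config R | forall i, E1 i (mu (B1 i))] `*`
    [set nu : config R | forall i, E2 i (nu (B2 i))]); last first.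
  have key (q : config R * config R) i : graft t q.1 q.2 (B i) =
      if p i then q.1 (B i) else q.2 (after t (B i)).
    rewrite graftE//; case: ifPn => [/asboolP pi|/negbTE /npast ->]; last first.
      by rewrite measure0 add0e.
    rewrite setIidl// (_ : after _ _ = set0) ?measure0 ?adde0//.
    rewrite -subset0 => -[u z] [/= /pi].
    rewrite /past /= !in_itv /= !andbT => -[/andP[_ tu] _] [u0 _].
    by move: tu; rewrite gerDl leNgt u0.
  apply/seteqP; split => q /=.
    move=> h; split => i; have := h i; rewrite key /E1 /E2 /B1 /B2; by case: ifP.
  move=> [h1 h2] i; have := h1 i; have := h2 i.
  by rewrite key /E1 /E2 /B1 /B2; case: ifP.
have tB1 : trivIset setT B1.
  by apply: trivIset_pointwise_sub tB => i; rewrite /B1; case: ifP => _ //; exact: sub0set.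
have tB2 : trivIset setT B2.
  move=> i j _ _ []; rewrite /B2; case: ifP => _; first by move=> q [].
  case: ifP => _; first by move=> q [].
  by move=> q [[h _] [h' _]]; apply: tB => //; eexists; split; [exact: h|exact: h'].
have B1q i : B1 i `<=` @quadrant R.
  by rewrite /B1; case: ifP => _ //; exact: sub0set.
have B2q i : B2 i `<=` @quadrant R.
  rewrite /B2; case: ifP => _; [exact: sub0set|move=> q [_ []]].
  by rewrite /quadrant /= !in_itv /= !andbT => /ltW.
transitivity (Q [set mu : config R | forall i, E1 i (mu (B1 i))] *
              Q [set nu : config R | forall i, E2 i (nu (B2 i))]).
  by apply: product_measure1E; exact: mev.
rewrite (poisson_indep mB1 B1q tB1 mE1) (poisson_indep mB2 B2q tB2 mE2) -big_split /=.
transitivity (\prod_i Q [set mu | [set (k i)%:R%:E : \bar R] (mu (B i))]); last first.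
  by symmetry; apply: (@poisson_indep I B (fun i => [set (k i)%:R%:E : \bar R])).
apply: eq_bigr => i _.
rewrite /E1 /E2 /B1 /B2; case: ifPn => [_|/negbTE pi].
  by rewrite [X in _ * X](_ : _ = 1) ?mule1// -(probability_setT Q).
rewrite [X in X * _](_ : _ = 1) ?mul1e; last by rewrite -(probability_setT Q).
by apply: poisson_after; [have [] := DB i|exact: npast].
Qed.

(** Finite measures that agree on a generating pi-system coincide; [count_events_disjoint] reduces
    the comparison to disjoint families. *)
Lemma graft_law t E : (0 <= t)%R -> measurable E ->
  (Q \x Q) [set q | E (graft t q.1 q.2)] = Q E.
Proof.
move=> t0 mE.
have [m hm] := @pushforward_measure _ _ _ _ _ (Q \x Q) _ (measurable_graft t0).
have Db : split_events (R := R) t `<=` bounded_events (R := R) by move=> B [].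
rewrite -[LHS]hm.
apply: (measure_unique (count_events (split_events t)) (fun=> setT)) => //.
- exact: measurableE_split.
- exact: count_events_setI.
- by move=> _; exact: count_events_setT.
- by rewrite bigcup_const.
- apply: count_events_disjoint => //.
  + by split; [split => //; exists 0%R|left].
  + move=> B C [[mB [r Br]] hB] [[mC _] _]; split.
      by split; [exact: measurableI|exists r => q [/Br]].
    case: hB => hB; [left => q [/hB//]|right].
    by rewrite setIAC hB set0I.
  + move=> B C [[mB [r Br]] hB] [[mC _] _]; split.
      by split; [exact: measurableD|exists r => q [/Br]].
    case: hB => hB; [left => q [/hB//]|right].
    by rewrite -subset0 -hB => q [[? _] ?].
  + by move=> I B k DB tB; rewrite hm; exact: graft_law_disjoint.
- move=> _; rewrite hm preimage_setT.
  by apply: le_lt_trans (probability_le1 _ measurableT) _; rewrite ltry.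
Qed.

(** By uniqueness of the product measure it is enough to treat rectangles. Given the first path, the
    two coordinates of the graft are independent, so the iterated integral factorises. *)
Lemma graft2_law t (E : set (Omega R)) : (0 <= t)%R -> measurable E ->
  ((Q \x Q) \x (Q \x Q)) [set q | E (graft2 t q.1 q.2)] = (Q \x Q) E.
Proof.
move=> t0 mE; pose P : probability (config R * config R)%type R := Q \x Q.
have [m hm] := @pushforward_measure _ _ _ _ _ (P \x P) _ (measurable_graft2 t0).
rewrite -[LHS]hm; symmetry; apply: product_measure_unique => //.
move=> A C mA mC; rewrite hm.
(* The probability that the past [mu], continued independently, ends up in [D]; by [graft_law] its
   mean is [Q D]. *)
pose sect (D : set (config R)) mu := Q [set nu | D (graft t mu nu)].
have mD (D : set (config R)) : measurable D ->
    measurable [set q : config R * config R | D (graft t q.1 q.2)].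
  by move=> mD; have := measurable_graft t0 measurableT mD; rewrite setTI.
have sectE (D : set (config R)) mu :
    sect D mu = Q (xsection [set q : config R * config R | D (graft t q.1 q.2)] mu).
  by rewrite /sect; congr (Q _); apply/seteqP; split => nu /=; rewrite /xsection /= inE.
have msect (D : set (config R)) : measurable D -> measurable_fun setT (sect D).
  move=> /mD mD'; rewrite (_ : sect D = Q \o
     xsection [set q : config R * config R | D (graft t q.1 q.2)]).
    exact: measurable_fun_xsection.
  by apply/funext => mu; rewrite sectE.
have sect0 (D : set (config R)) mu : 0 <= sect D mu by exact: measure_ge0.
have intsect (D : set (config R)) : measurable D -> \int[Q]_mu sect D mu = Q D.
  move=> mD'; rewrite -(graft_law t0 mD').
  by apply: eq_integral => mu _; rewrite sectE.
transitivity (\int[Q \x Q]_w (sect A w.1 * sect C w.2)).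
  apply: eq_integral => w _ /=; rewrite -[RHS]product_measure1E.
  - congr ((Q \x Q) _); apply/seteqP.
    by split => w' /=; rewrite /xsection /= inE.
  - have := measurable_xsection w.1 (mD _ mA).
    by congr measurable; apply/seteqP; split => w' /=; rewrite /xsection /= inE.
  - have := measurable_xsection w.2 (mD _ mC).
    by congr measurable; apply/seteqP; split => w' /=; rewrite /xsection /= inE.
rewrite fubini_tonelli1 /fubini_F /=; last 2 first.
- apply: emeasurable_funM.
    exact: (measurableT_comp (msect _ mA) measurable_fst).
  exact: (measurableT_comp (msect _ mC) measurable_snd).
- by move=> w; exact: mule_ge0.
rewrite -(intsect _ mA) -(intsect _ mC) -ge0_integralZr//.
- by apply: eq_integral => mu _; rewrite ge0_integralZl//; exact: msect.
- exact: msect.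
- exact: integral_ge0.
Qed.
End poisson.

(** * Limits of counts *)

Section eventually.
Context d (T : measurableType d) (R : realType).
Variables (F : nat -> set T) (A : set T).
Hypothesis mF : forall n, measurable (F n).
Hypothesis FA : forall x, exists N, forall n, (N <= n)%N -> F n x <-> A x.

Let L N := \bigcap_(n in [set n | (N <= n)%N]) F n.

Let mL N : measurable (L N).
Proof. exact: bigcap_measurableType. Qed.

Let LA : \bigcup_N L N = A.
Proof.
apply/seteqP; split => x.
  move=> [N _ LN]; have [M hM] := FA x.
  by apply/(hM (maxn N M)); rewrite ?leq_maxr//; apply: LN; exact: leq_maxl.
by move=> Ax; have [M hM] := FA x; exists M => // n /= Mn; exact/(hM n).
Qed.

Lemma eventually_measurable : measurable A.
Proof. by rewrite -LA; exact: bigcup_measurable. Qed.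

(** The sets [L N] increase to [A] and [L N] sits inside [F N], so continuity from below transfers
    the bound. *)
Lemma eventually_measure_le (P : probability T R) (c : \bar R) :
  (forall n, P (F n) <= c) -> P A <= c.
Proof.
move=> Pc; have ndL : nondecreasing_seq L.
  move=> n m nm; apply/subsetPset => x Ln k /= mk; apply: Ln.
  exact: leq_trans mk.
have cv : P (L n) @[n --> \oo] --> P A.
  rewrite -LA; apply: nondecreasing_cvg_mu => //.
  by rewrite LA; exact: eventually_measurable.
rewrite -(cvg_lim _ cv)//; apply: lime_le; first by apply/cvg_ex; eexists; exact: cv.
apply: nearW => n; apply: le_trans (Pc n).
by apply: le_measure; rewrite ?inE// => x; apply; exact: leqnn.
Qed.
End eventually.

Lemma eventually_measure d (T : measurableType d) (R : realType)
    (F : nat -> set T) (A : set T) (P : probability T R) (c : \bar R) :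
  (forall n, measurable (F n)) ->
  (forall x, exists N, forall n, (N <= n)%N -> F n x <-> A x) ->
  (forall n, P (F n) = c) -> P A = c.
Proof.
move=> mF FA Pc.
have mA : measurable A by exact: eventually_measurable FA.
apply/eqP; rewrite eq_le (eventually_measure_le mF FA) ?Pc//=; last first.
  by move=> n; rewrite Pc.
(* The reverse inequality is the same bound for the complements, the total mass being 1. *)
have hC : P (~` A) <= 1 - c.
  apply: (@eventually_measure_le _ _ _ (fun n => ~` F n)).
  - by move=> n; exact: measurableC.
  - move=> x; have [N hN] := FA x; exists N => n /hN [h1 h2].
    by split => h ?; apply: h; auto.
  - by move=> n; rewrite probability_setC// Pc.
move: hC; rewrite probability_setC//.
have cfin : c \is a fin_num by rewrite -(Pc 0%N) fin_num_measure.
have Afin : P A \is a fin_num by exact: fin_num_measure.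
by rewrite -(fineK cfin) -(fineK Afin) -!EFinB !lee_fin lerD2l lerN2.
Qed.

Section limits.
Variable R : realType.
Implicit Types (mu nu : config R) (B : set (R * R)) (s t r : R) (w : Omega R).

(** The set [D N] of points where some [F n] with [N <= n] differs from [B] decreases to the empty
    set inside a box of finite mass, so its mass tends to 0. *)
Lemma config_eventually mu (F : nat -> set (R * R)) B r :
  (forall n, measurable (F n)) -> measurable B ->
  (forall n, F n `<=` box r r) -> B `<=` box r r ->
  (forall q, exists N, forall n, (N <= n)%N -> F n q <-> B q) ->
  exists N, forall n, (N <= n)%N -> mu (F n) = mu B.
Proof.
move=> mF mB Fr Br FB.
pose D N := \bigcup_(n in [set n | (N <= n)%N]) ((F n `\` B) `|` (B `\` F n)).
have mD N : measurable (D N).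
  by apply: bigcup_measurable => n _; apply: measurableU; exact: measurableD.
have Dr N : D N `<=` box r r by move=> q [n _ [[/Fr]|[/Br]]].
have D0 : \bigcap_N D N = set0.
  rewrite -subset0 => q hq; have [N hN] := FB q.
  by have [n /= /hN [h1 h2] [[/h1]|[/h2]]] := hq N I.
have cv : mu (D n) @[n --> \oo] --> mu (\bigcap_N D N).
  apply: nonincreasing_cvg_mu => //.
  - exact: config_fin (Dr 0%N).
  - exact: bigcap_measurableType.
  - move=> n m nm; apply/subsetPset => q [k /= mk h]; exists k => //=.
    exact: leq_trans mk.
rewrite D0 measure0 in cv.
(* The masses are natural numbers tending to 0, so one of them vanishes; from then on [F n] and [B]
   differ by a null set. *)
have [N DN0] : exists N, mu (D N) = 0.
  have /fine_cvgP[_ /cvgrPdist_lt /(_ 1%R ltr01) [N _ hN]] := cv.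
  exists N; have := hN N (leqnn N).
  have [k Dk] := config_nat mu (mD N) (Dr N).
  rewrite /= Dk sub0r normrN /= normr_nat => h.
  by move: h; rewrite (_ : 1%R = 1%:R :> R)// ltr_nat ltnS leqn0 => /eqP ->.
exists N => n Nn; apply/eqP; rewrite eq_le; apply/andP; split.
  rewrite -[leRHS]adde0 -DN0; apply: le_trans (measureU2 mu mB (mD N)).
  apply: le_measure; rewrite ?inE//; first exact: measurableU.
  move=> q Fq; have [Bq|nBq] := pselect (B q); first by left.
  by right; exists n => //; left.
rewrite -[leRHS]adde0 -DN0; apply: le_trans (measureU2 mu (mF n) (mD N)).
apply: le_measure; rewrite ?inE//; first exact: measurableU.
move=> q Fq; have [Bq|nBq] := pselect (F n q); first by left.
by right; exists n => //; right.
Qed.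

Definition right_approx t (u : nat -> R) :=
  forall e : R, (0 < e)%R -> exists N, forall n, (N <= n)%N -> (t < u n < t + e)%R.

(** At each point, membership in [past (u n)] stabilises because [u n] approaches [t] from the right
    and [past t] is closed there; membership in [after (u n) B] stabilises because [B] is
    right-clopen. Integer counts then stabilise as well. *)
Lemma graft_eventually t (u : nat -> R) mu nu B : (0 <= t)%R ->
  (forall n, (t < u n)%R) -> right_approx t u -> rc_events B ->
  exists N, forall n, (N <= n)%N -> graft (u n) mu nu B = graft t mu nu B.
Proof.
move=> t0 tu ut [[mB [r Br]] rcB].
have u0 n : (0 <= u n)%R by rewrite (le_trans t0)// ltW.
have [N1 h1] : exists N, forall n, (N <= n)%N ->
    mu (B `&` past (u n)) = mu (B `&` past t).
  apply: (@config_eventually _ _ _ r).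
  - by move=> n; apply: measurableI => //; exact: measurable_past.
  - by apply: measurableI => //; exact: measurable_past.
  - by move=> n q [/Br].
  - by move=> q [/Br].
  move=> [v z]; have [vt|tv] := leP v t.
    exists 0%N => n _; rewrite /past /= !in_itv /= vt.
    by rewrite (le_trans vt (ltW (tu n))).
  have [|N hN] := ut (v - t)%R; first by rewrite subr_gt0.
  exists N => n /hN /andP[_]; rewrite addrC subrK => unv.
  by rewrite /past /= !in_itv /= !leNgt unv tv !andbF.
have aft x : (0 <= x)%R -> after x B `<=` box r r.
  move=> x0; apply: subset_trans (after_box x0 Br) _.
  by apply: box_mono => //; rewrite lerBlDr lerDl.
have [N2 h2] : exists N, forall n, (N <= n)%N ->
    nu (after (u n) B) = nu (after t B).
  apply: (@config_eventually _ _ _ r).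
  - by move=> n; exact: measurable_after.
  - exact: measurable_after.
  - by move=> n; exact: aft.
  - exact: aft.
  move=> [v z]; have [e e0 he] := rcB (t + v)%R z.
  have [N hN] := ut e e0.
  exists N => n /hN /andP[tun unt].
  have [ha hb] : B ((t + v + (u n - t))%R, z) <-> B ((t + v)%R, z).
    by apply: he; rewrite subr_ge0 (ltW tun) ltrBlDl.
  have E : (t + v + (u n - t) = u n + v)%R by rewrite addrC addrA subrK.
  rewrite E in ha hb.
  by split => -[Bq ?]; split => //; [exact: ha|exact: hb].
exists (maxn N1 N2) => n; rewrite geq_max => /andP[n1 n2].
by rewrite !graftE// h1// h2.
Qed.

Lemma count_event_eventually t (u : nat -> R) mu nu E : (0 <= t)%R ->
  (forall n, (t < u n)%R) -> right_approx t u -> count_events (@rc_events R) E ->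
  exists N, forall n, (N <= n)%N -> E (graft (u n) mu nu) <-> E (graft t mu nu).
Proof.
move=> t0 tu ut [I [B [k [DB ->]]]].
have /choice [N hN] : forall i, exists N, forall n, (N <= n)%N ->
    graft (u n) mu nu (B i) = graft t mu nu (B i).
  by move=> i; exact: graft_eventually.
exists (\max_i N i)%N => n hn.
have e i : graft (u n) mu nu (B i) = graft t mu nu (B i).
  by apply: hN; exact: leq_trans (leq_bigmax i) hn.
by split => /= h i; rewrite -?h ?e.
Qed.

(** Having [setT] in both families turns each cylinder over a generator into a rectangle of
    generators. *)
Lemma prod_measurableE d1 d2 (T1 : measurableType d1) (T2 : measurableType d2)
    (G1 : set (set T1)) (G2 : set (set T2)) :
  @measurable _ T1 = <<s G1 >> -> @measurable _ T2 = <<s G2 >> ->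
  G1 setT -> G2 setT ->
  @measurable _ (T1 * T2)%type = <<s [set A `*` B | A in G1 & B in G2] >>.
Proof.
move=> m1 m2 G1T G2T; apply/seteqP; split; last first.
  apply: smallest_sub; first exact: sigma_algebra_measurable.
  move=> _ [A GA [B GB <-]]; apply: measurableX.
    by rewrite m1; exact: sub_sigma_algebra.
  by rewrite m2; exact: sub_sigma_algebra.
rewrite measurable_prod_measurableType.
have sS := smallest_sigma_algebra setT [set A `*` B | A in G1 & B in G2].
apply: smallest_sub => // _ [A mA [B mB <-]].
rewrite (_ : A `*` B = fst @^-1` A `&` snd @^-1` B)//.
apply: (sigma_algebraI sS).
- move: mA; rewrite m1; apply: (sigma_algebra_preimageT sS) => C GC.
  apply: sub_sigma_algebra; exists C => //; exists setT => //.
  by apply/seteqP; split => // q [].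
- move: mB; rewrite m2; apply: (sigma_algebra_preimageT sS) => C GC.
  apply: sub_sigma_algebra; exists setT => //; exists C => //.
  by apply/seteqP; split => // q [].
Qed.

Definition count_events2 : set (set (Omega R)) :=
  [set A `*` B | A in count_events (@rc_events R) & B in count_events (@rc_events R)].

Lemma measurableE_count2 : @measurable _ (config R * config R)%type =
  <<s count_events2 >>.
Proof.
by apply: prod_measurableE; [exact: measurableE_rc|exact: measurableE_rc
  |exact: count_events_setT|exact: count_events_setT].
Qed.

Lemma count_events2_setI : setI_closed count_events2.
Proof.
move=> _ _ [A GA [B GB <-]] [A' GA' [B' GB' <-]].
exists (A `&` A'); first exact: count_events_setI.
exists (B `&` B'); first exact: count_events_setI.
by apply/seteqP; split => q /= [[? ?] [? ?]].
Qed.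

Lemma count_event2_eventually t (u : nat -> R) w w' E : (0 <= t)%R ->
  (forall n, (t < u n)%R) -> right_approx t u -> count_events2 E ->
  exists N, forall n, (N <= n)%N -> E (graft2 (u n) w w') <-> E (graft2 t w w').
Proof.
move=> t0 tu ut [A GA [B GB <-]].
have [N1 h1] := count_event_eventually w.1 w'.1 t0 tu ut GA.
have [N2 h2] := count_event_eventually w.2 w'.2 t0 tu ut GB.
exists (maxn N1 N2) => n; rewrite geq_max => /andP[/h1 [a b] /h2 [c d]].
by split => -[/= ? ?]; split => /=; auto.
Qed.

End limits.

(** * Markov property at a stopping time *)

Section stopping.
Variables (R : realType) (tau : Omega R -> R).
Hypothesis htau : stopping_time tau.
Hypothesis tau0 : forall w, (0 <= tau w)%R.
Implicit Types (mu nu : config R) (B : set (R * R)) (s t r : R) (w : Omega R).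

Lemma config_filtration_mono s t : (s <= t)%R ->
  @config_filtration R s `<=` @config_filtration R t.
Proof.
move=> st; apply: sub_sigma_algebra2 => _ [B [mB [r Br]] [E mE <-]].
exists B; last by exists E.
by split => //; exists r; apply: subset_trans Br _; exact: box_mono.
Qed.

Lemma filtration_mono s t : (s <= t)%R -> @filtration R s `<=` @filtration R t.
Proof.
move=> st; apply: sub_sigma_algebra2 => _ [A hA [B hB <-]].
by exists A; [|exists B => //]; exact: (config_filtration_mono st).
Qed.

Lemma stopping_time_lt t : (0 <= t)%R -> filtration t [set w | (tau w < t)%R].
Proof.
move=> t0; have [F0 FC FU] := @sigma_algebra_filtration R t.
(* The guard is there because [stopping_time] only speaks of nonnegative times; by [tau0] it loses
   no path. *)
rewrite (_ : [set w | _] = \bigcup_n (if (0 <= t - n.+1%:R^-1)%R then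
   [set w | (tau w <= t - n.+1%:R^-1)%R] else set0)).
  apply: FU => n; case: ifPn => // h.
  by apply: (filtration_mono _ (htau h)); rewrite gerDl oppr_le0.
apply/seteqP; split => w; last first.
  move=> [n _]; case: ifPn => // h /= /le_lt_trans; apply.
  by rewrite gtrDl oppr_lt0.
move=> /= wt; have d0 : (0 < t - tau w)%R by rewrite subr_gt0.
pose n := Num.truncn (t - tau w)^-1.
have h : (tau w <= t - n.+1%:R^-1)%R.
  rewrite lerBrDr -lerBrDl -[leRHS]invrK lef_pV2 ?posrE ?invr_gt0//.
  exact/ltW/truncnS_gt.
by exists n => //; rewrite (le_trans (tau0 w) h).
Qed.

(** For [t = tau w], the events [tau <= t] and [tau < t] are both decided by the path up to [t]: the
    first gives an inequality, the second excludes strictness. *)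
Lemma stopping_time_agree w w' : agree2 (tau w) w w' -> tau w' = tau w.
Proof.
move=> a; have ht := tau0 w.
have le' : (tau w' <= tau w)%R.
  exact: (filtration_agree (htau ht) a (lexx (tau w))).
apply/eqP; rewrite eq_le le' /= leNgt; apply/negP => lt'.
have := filtration_agree (stopping_time_lt ht) (agree2_sym a) lt'.
by rewrite /= ltxx.
Qed.

Lemma filtration_at_agree (B : set (Omega R)) w w' :
  filtration_at tau B -> agree2 (tau w) w w' -> B w <-> B w'.
Proof.
move=> [mB hB] a; have ht := tau0 w; have e := stopping_time_agree a.
split => Bw.
  by have [] := filtration_agree (hB _ ht) a (conj Bw (lexx _)).
have Bw' : (B `&` [set w' | (tau w' <= tau w)%R]) w' by split => //=; rewrite e.
by have [] := filtration_agree (hB _ ht) (agree2_sym a) Bw'.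
Qed.

Definition grid (n k : nat) : R := (k.+1%:R / n.+1%:R)%R.

(** Chosen so that [grid n (grid_index n w)] is the first multiple of [1 / (n + 1)] strictly after
    [tau w], as [right_approx] demands. *)
Definition grid_index n w := Num.truncn (tau w * n.+1%:R)%R.

Lemma grid_gt n w : (tau w < grid n (grid_index n w))%R.
Proof. by rewrite /grid ltr_pdivlMr//; exact: truncnS_gt. Qed.

Lemma grid_approx w : right_approx (tau w) (fun n => grid n (grid_index n w)).
Proof.
move=> e e0; exists (Num.truncn e^-1) => n Nn; rewrite grid_gt /=.
rewrite /grid ltr_pdivrMr// mulrDl -addn1 natrD ler_ltD//.
  by rewrite truncn_le mulr_ge0.
rewrite -ltr_pdivrMl// mulr1; apply: lt_le_trans (truncnS_gt _) _.
by rewrite ler_nat.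
Qed.

Lemma grid_index_filtration n k :
  filtration (grid n k) [set w | grid_index n w = k].
Proof.
have g0 j : (0 <= j%:R / n.+1%:R :> R)%R by [].
have sS := @sigma_algebra_filtration R (grid n k).
rewrite (_ : [set w | _] = [set w | (tau w < grid n k)%R] `&`
    ~` [set w | (tau w < k%:R / n.+1%:R)%R]).
  apply: (sigma_algebraI sS).
    exact: (stopping_time_lt (g0 k.+1)).
  apply: (sigma_algebraC sS).
  apply: filtration_mono (stopping_time_lt (g0 k)).
  by rewrite ler_pM2r ?invr_gt0// ler_nat.
apply/seteqP; split => w /=.
  move=> <-; split; first exact: grid_gt.
  apply/negP; rewrite -leNgt ler_pdivrMr//.
  by rewrite truncn_le mulr_ge0.
move=> [h1 /negP]; rewrite -leNgt => h2.
by apply: truncn_def; rewrite -ler_pdivrMr// h2 -ltr_pdivlMr.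
Qed.

(** The map Phi, with [tau] read on the first path. *)
Definition grafted (q : Omega R * Omega R) : Omega R := graft2 (tau q.1) q.1 q.2.

Let grafted_grid n (q : Omega R * Omega R) : Omega R :=
  graft2 (grid n (grid_index n q.1)) q.1 q.2.

Let grid0 n k : (0 <= grid n k)%R.
Proof. by rewrite /grid divr_ge0. Qed.

(** The event is known at time [grid n k], up to which grafting changes nothing. *)
Let grid_index_graft2 n k (q : Omega R * Omega R) : grid_index n q.1 = k <->
  grid_index n (graft2 (grid n k) q.1 q.2) = k.
Proof.
have a := agree2_graft2 q.1 q.2 (grid0 n k).
split => h.
  by have := filtration_agree (@grid_index_filtration n k) a h.
by have := filtration_agree (@grid_index_filtration n k) (agree2_sym a) h.
Qed.

(** The index is read on the grafted path instead of [q.1], which makes each piece the preimage of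
    one event under grafting at a fixed time. *)
Let grafted_gridE n (E : set (Omega R)) : [set q | E (grafted_grid n q)] =
  \bigcup_k [set q | (E `&` [set w | grid_index n w = k]) (graft2 (grid n k) q.1 q.2)].
Proof.
apply/seteqP; split => q /=.
  by move=> Eq; exists (grid_index n q.1) => //; split => //; exact/grid_index_graft2.
by move=> [k _ [Eq /grid_index_graft2 hk]]; rewrite /grafted_grid hk.
Qed.

Let measurable_piece n k (E : set (Omega R)) : measurable E ->
  measurable (E `&` [set w | grid_index n w = k]).
Proof.
move=> mE; apply: measurableI => //.
exact: (filtration_measurable (grid0 n k) (@grid_index_filtration n k)).
Qed.

Let measurable_graft2_pre t (E : set (Omega R)) : (0 <= t)%R -> measurable E ->
  measurable [set q : Omega R * Omega R | E (graft2 t q.1 q.2)].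
Proof.
by move=> t0 mE; have := measurable_graft2 t0 measurableT mE; rewrite setTI.
Qed.

Let measurable_grafted_grid n (E : set (Omega R)) : measurable E ->
  measurable [set q | E (grafted_grid n q)].
Proof.
move=> mE; rewrite grafted_gridE; apply: bigcup_measurable => k _.
by apply: measurable_graft2_pre; [exact: grid0|exact: measurable_piece].
Qed.

Let grafted_eventually (E : set (Omega R)) : count_events2 E ->
  forall q, exists N, forall n, (N <= n)%N -> E (grafted_grid n q) <-> E (grafted q).
Proof.
move=> GE q; apply: count_event2_eventually => //.
- by move=> n; exact: grid_gt.
- exact: grid_approx.
Qed.

(** For a generating event, membership of the grid approximations eventually equals that of the
    limit, and the approximations are measurable as countable gluings of fixed-time grafts. *)
Lemma measurable_grafted : measurable_fun setT grafted.
Proof.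
apply: (measurability (@count_events2 R) (@measurableE_count2 R)).
move=> _ [E GE <-]; rewrite setTI.
apply: (@eventually_measurable _ _ (fun n => [set q | E (grafted_grid n q)])).
  move=> n; apply: measurable_grafted_grid.
  by rewrite [measurable]measurableE_count2; exact: sub_sigma_algebra.
exact: grafted_eventually.
Qed.

Section law.
Variable Q : probability (config R) R.
Hypothesis hQ : poisson_random_measure_law Q.
Let P : probability (config R * config R)%type R := Q \x Q.

Let grafted_grid_law n (E : set (Omega R)) : measurable E ->
  (P \x P) [set q | E (grafted_grid n q)] = P E.
Proof.
move=> mE; rewrite grafted_gridE.
pose EK k := E `&` [set w | grid_index n w = k].
have tEK : trivIset setT EK.
  by move=> i j _ _ [w [[_ /= <-] [_ /= <-]]].
have mEK k : measurable (EK k) by exact: measurable_piece.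
have EE : E = \bigcup_k EK k.
  apply/seteqP; split => w; last by move=> [k _ []].
  by move=> Ew; exists (grid_index n w).
rewrite [in RHS]EE [RHS]measure_semi_bigcup//; last exact: bigcup_measurable.
rewrite measure_semi_bigcup//.
- by apply: eq_eseriesr => k _; exact: (graft2_law hQ (grid0 n k) (mEK k)).
- by move=> k; exact: measurable_graft2_pre (grid0 n k) (mEK k).
- move=> i j _ _ [q [h h']].
  by have [_ /grid_index_graft2 <-] := h; have [_ /grid_index_graft2] := h'.
- by rewrite -grafted_gridE; exact: measurable_grafted_grid.
Qed.

(** Every grid approximation has law [P]; on count events the probabilities pass to the limit, and
    these events determine a probability. *)
Lemma grafted_law (E : set (Omega R)) : measurable E ->
  (P \x P) [set q | E (grafted q)] = P E.
Proof.
move=> mE; have [m hm] := @pushforward_measure _ _ _ _ _ (P \x P) _ measurable_grafted.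
rewrite -[LHS]hm.
apply: (measure_unique (@count_events2 R) (fun=> setT)) => //.
- exact: measurableE_count2.
- exact: count_events2_setI.
- move=> _; exists setT; first exact: count_events_setT.
  exists setT; first exact: count_events_setT.
  by apply/seteqP; split.
- by rewrite bigcup_const.
- move=> A GA; rewrite hm.
  have mA : measurable A.
    by rewrite [measurable]measurableE_count2; exact: sub_sigma_algebra.
  apply: (@eventually_measure _ _ _ (fun n => [set q | A (grafted_grid n q)])).
  + by move=> n; exact: measurable_grafted_grid.
  + exact: grafted_eventually.
  + by move=> n; exact: grafted_grid_law.
- move=> _; rewrite hm preimage_setT.
  by apply: le_lt_trans (probability_le1 _ measurableT) _; rewrite ltry.
Qed.
End law.
End stopping.

(** * Predictability of the shifted control *)

Section predictable.
Variables (R : realType) (A : topologicalType).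
Implicit Types (s t u v : R) (w : Omega R) (alpha : R -> Omega R -> A).

(** The sections at [w] of the generating sets are [{0}], []u, v]] or empty, hence Borel. *)
Lemma predictable_section alpha w (U : set A) : predictable alpha -> borel A U ->
  measurable [set q : R | (0 <= q)%R /\ U (alpha q w)].
Proof.
move=> halpha /halpha hC.
pose C := [set p : R * Omega R | (0 <= p.1)%R /\ U (alpha p.1 p.2)].
pose D1 : set R := `[0%R, +oo[%classic.
have D1E q : D1 q = (0 <= q)%R by rewrite /D1 /= in_itv /= andbT.
rewrite (_ : [set q | _] = D1 `&` (fun q => (q, w)) @^-1` C); last first.
  apply/seteqP; split => q; rewrite /C /= D1E; last by move=> [_].
  by move=> [? ?].
apply: (@sigma_algebra_preimage _ _ D1 [set p : R * Omega R | (0 <= p.1)%R]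
  (fun q => (q, w)) measurable _ _ _ _ _ hC).
- split => [|B mB|F mF]; [exact: measurable0| |exact: bigcup_measurable].
  by apply: measurableD => //; exact: measurable_itv.
- by move=> q; rewrite D1E.
move=> _ [[B FB <-]|[u [v [B [u0 uv FB ->]]]]];
  (apply: measurableI; first exact: measurable_itv).
- have [Bw|nBw] := pselect (B w).
    rewrite (_ : _ @^-1` _ = [set 0%R])//.
    by apply/seteqP; split => q /=; [move=> []|move=> ?; split].
  by rewrite (_ : _ @^-1` _ = set0)// -subset0 => q [].
- have [Bw|nBw] := pselect (B w).
    rewrite (_ : _ @^-1` _ = `]u, v]%classic)//.
    by apply/seteqP; split => q /=; [move=> []|move=> ?; split].
  by rewrite (_ : _ @^-1` _ = set0)// -subset0 => q [].
Qed.

Lemma predictable_shift_control alpha t w : (0 <= t)%R -> predictable alpha ->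
  predictable (shift_control alpha t w).
Proof.
move=> t0 halpha U /halpha hC.
pose C := [set p : R * Omega R | (0 <= p.1)%R /\ U (alpha p.1 p.2)].
pose D : set (R * Omega R) := [set p | (0 <= p.1)%R].
pose f (p : R * Omega R) := ((t + p.1)%R, graft2 t w p.2).
rewrite (_ : [set p : R * Omega R | (0 <= p.1)%R /\
    U (shift_control alpha t w p.1 p.2)] = D `&` f @^-1` C); last first.
  apply/seteqP; split => p; last by move=> [p0 [_ Up]]; split.
  by move=> [p0 Up]; do 2!split => //; rewrite /= addr_ge0.
have sS := smallest_sigma_algebra D (@predictable_gen R).
have [S0 SC SU] := sS.
apply: (sigma_algebra_preimage sS _ _ hC).
  by move=> p p0; rewrite /= addr_ge0.
move=> _ [[B FB <-]|[u [v [B [u0 uv FB ->]]]]].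
(* Times [t + p] with [p >= 0] meet the generator at time 0 only if [t = 0]. *)
- have [tt0|tn0] := eqVneq t 0%R.
    apply: sub_sigma_algebra; left; exists (graft2 0%R w @^-1` B).
      have := @filtration_graft2 R 0%R 0%R w B; rewrite subr0 lexx.
      exact.
    apply/seteqP; split => -[p w'] /=; rewrite /D /f /= tt0 add0r.
      by move=> [-> Bw'].
    by move=> [p0 [-> Bw']].
  rewrite (_ : _ `&` _ = set0)// -subset0 => -[p w'] [/= p0 [/= /eqP]].
  by rewrite paddr_eq0// (negbTE tn0).
- have [tu|ut] := leP t u.
    (* The interval lies after [t], so it is translated back by [t], and the event moves to time
       [u - t] by [filtration_graft2]. *)
    apply: sub_sigma_algebra; right; exists (u - t)%R, (v - t)%R, (graft2 t w @^-1` B).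
    split.
    + by rewrite subr_ge0.
    + by rewrite lerD2r.
    + by apply: filtration_graft2; rewrite ?t0.
    apply/seteqP; split => -[p w']; rewrite /D /f /= !in_itv /= ltrBlDl lerBrDl.
      by move=> [_ []].
    move=> [/andP[h1 h2] h3]; split; last by rewrite h1 h2.
    by rewrite -(lerD2l t) addr0 (le_trans tu)// ltW.
  have Bgraft w' : B (graft2 t w w') <-> B w.
    have a := agree2_graft2 w w' t0.
    have FBt : filtration t B by apply: filtration_mono FB; exact: ltW.
    split => h; [exact: (filtration_agree FBt (agree2_sym a) h)|].
    exact: (filtration_agree FBt a h).
  have [Bw|nBw] := pselect (B w); last first.
    rewrite (_ : _ `&` _ = set0)// -subset0 => -[p w'] [/= _ [_ /=]].
    by move/Bgraft.
  have [tv|vt] := leP t v; last first.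
    rewrite (_ : _ `&` _ = set0)// -subset0 => -[p w'] [/= p0 [/=]].
    rewrite in_itv /= => /andP[_ pv] _.
    by move: pv; rewrite leNgt (lt_le_trans vt)// lerDl.
  (* The remaining times form the closed interval [[0, v - t]], so time 0 needs its own
     generator. *)
  rewrite (_ : _ `&` _ = \bigcup_i bigcup2 ([set 0%R] `*` [set: Omega R])
      (`]0%R, (v - t)%R]%classic `*` [set: Omega R]) i).
    apply: SU => -[|[|n]] //=; apply: sub_sigma_algebra.
      by left; exists setT => //; exact: (sigma_algebra_setT (@sigma_algebra_filtration R _)).
    right; exists 0%R, (v - t)%R, setT; rewrite subr_ge0.
    by split => //; exact: (sigma_algebra_setT (@sigma_algebra_filtration R _)).
  rewrite bigcup2E; apply/seteqP; split => -[p w']; rewrite /D /f /=.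
    rewrite !in_itv /= => -[p0 [/andP[_ h] _]].
    have [->|pn0] := eqVneq p 0%R; first by left.
    by right; split => //; rewrite lt_neqAle eq_sym pn0 p0 lerBrDl.
  rewrite !in_itv /= => -[[-> _]|[/andP[p0 h] _]].
    by rewrite addr0 ut tv; split => //; split => //; exact/Bgraft.
  split; first exact: ltW.
  split; last exact/Bgraft.
  by rewrite -lerBrDl h (lt_trans ut)// ltrDl.
Qed.

End predictable.

(** * Measurability of the jump rates along a path *)

Section cadlag_paths.
Variable R : realType.
Implicit Types (f g : R -> nat) (s t u v : R).

(** The values are discrete, so convergence means being eventually equal to the limit. *)
Lemma cadlag_right f t : cadlag f -> (0 <= t)%R ->
  exists2 e : R, (0 < e)%R & forall u, (t <= u < t + e)%R -> f u = f t.
Proof.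
move=> [hr _] t0; have [e /= e0 he] := hr t t0 _ (discrete_set1 (f t)).
exists e => // u /andP[]; rewrite le_eqVlt => /predU1P[->//|tu ut].
apply: he => //=.
by rewrite ltr0_norm ?subr_lt0// opprB ltrBlDl.
Qed.

Lemma cadlag_left f t : cadlag f -> (0 < t)%R ->
  exists2 e : R, (0 < e)%R & forall u, (t - e < u < t)%R -> f u = left_limit f t.
Proof.
move=> [_ hl] t0; have [l fl] := hl t t0.
have -> : left_limit f t = l by apply: cvg_lim => //; exact: discrete_hausdorff.
have [e /= e0 he] := fl _ (discrete_set1 l).
exists e => // u /andP[h1 h2]; apply: he => //=.
by rewrite ger0_norm ?subr_ge0 ?(ltW h2)// ltrBlDl -ltrBlDr.
Qed.

Lemma cadlag_shift f t : (0 <= t)%R -> cadlag f -> cadlag (fun u => f (t + u)%R).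
Proof.
move=> t0 cf; split => u u0.
  have [|e e0 he] := cadlag_right cf (t := (t + u)%R); first exact: addr_ge0.
  move=> B /nbhs_singleton Bf; exists e => //= v.
  move=> /= uv u_v; rewrite he//.
  rewrite lerD2l (ltW u_v) -addrA ltrD2l.
  by move: uv; rewrite ltr0_norm ?subr_lt0// opprB ltrBlDl.
have [|e e0 he] := cadlag_left cf (t := (t + u)%R); first exact: ltr_wpDl.
exists (left_limit f (t + u)%R) => B /nbhs_singleton Bf; exists e => //= v.
move=> /= uv v_u; rewrite he// ltrD2l v_u andbT -addrA ltrD2l.
by move: uv; rewrite gtr0_norm ?subr_gt0// ltrBlDl -ltrBlDr.
Qed.

Lemma left_limit_ext f g s t : cadlag f -> cadlag g -> (0 < t)%R -> (s < t)%R ->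
  (forall u, (s < u < t)%R -> f u = g u) -> left_limit f t = left_limit g t.
Proof.
move=> cf cg t0 st fg; have [e e0 he] := cadlag_left cf t0.
have [e' e'0 he'] := cadlag_left cg t0.
pose m := Num.max s (Num.max (t - e) (t - e'))%R.
have mt : (m < t)%R by rewrite !gt_max st !gtrBl e0 e'0.
have := midf_lt mt; set u := ((m + t) / 2)%R => -[mu ut].
move: mu; rewrite !gt_max => /and3P[su eu e'u].
by rewrite -(he u) ?eu ?ut// -(he' u) ?e'u ?ut// fg// su ut.
Qed.

Lemma left_limit_shift f t u : cadlag f -> (0 <= t)%R -> (0 < u)%R ->
  left_limit (fun v => f (t + v)%R) u = left_limit f (t + u)%R.
Proof.
move=> cf t0 u0; have tu0 : (0 < t + u)%R by exact: ltr_wpDl.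
have [e e0 he] := cadlag_left cf tu0.
have [e' e'0 he'] := cadlag_left (cadlag_shift t0 cf) u0.
pose m := (Num.max (u - e) (u - e'))%R.
have mt : (m < u)%R by rewrite !gt_max !gtrBl e0 e'0.
have := midf_lt mt; set v := ((m + u) / 2)%R => -[mv vu].
move: mv; rewrite !gt_max => /andP[ev e'v].
by rewrite -(he' v) ?e'v// -(he (t + v)%R)// ltrD2l vu -addrA ltrD2l ev.
Qed.

(** The left limit at [u] is [n] exactly when, for some rational [r < u], [f] equals [n] at all
    rationals between [r] and [u]. This leaves only countable operations on intervals. *)
Lemma measurable_left_limit f (n : nat) : cadlag f ->
  measurable [set u : R | (0 < u)%R /\ left_limit f u = n].
Proof.
move=> cf.
pose bad (r r' : rat) := (r < r')%R /\ f (ratr r') <> n.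
pose X (r : rat) : set R := [set u | (0 < u)%R /\ (ratr r < u)%R /\
  forall r', bad r r' -> (u <= ratr r')%R].
rewrite (_ : [set u | _] = \bigcup_r X r).
  apply: bigcupT_measurable_rat => r.
  rewrite (_ : X r = `]0%R, +oo[%classic `&` (`](ratr r), +oo[%classic `&`
      ~` (\bigcup_r' (if `[< bad r r' >] then `](ratr r'), +oo[%classic else set0)))).
    apply: measurableI => //; apply: measurableI => //; apply: measurableC.
    by apply: bigcupT_measurable_rat => r'; case: ifP.
  apply/seteqP; split => u; rewrite /X /= !in_itv /= !andbT.
    move=> [u0 [ru h]]; split => //; split => // -[r' _]; case: asboolP => // b.
    by rewrite /= in_itv /= andbT ltNge h.
  move=> [u0 [ru h]]; split => //; split => // r' b; rewrite leNgt.
  apply/negP => h'; apply: h; exists r' => //; case: asboolP => // _.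
  by rewrite /= in_itv /= andbT.
apply/seteqP; split => u.
  move=> /= [u0 fu]; have [e e0 he] := cadlag_left cf u0.
  have ue : (u - e < u)%R by rewrite gtrBl.
  have [r] := rat_in_itvoo ue; rewrite in_itv /= => /andP[er ru].
  exists r => //; split => //; split => // r' [rr' fr'].
  rewrite leNgt; apply/negP => r'u; apply: fr'; rewrite -fu; apply: he.
  by rewrite r'u andbT (lt_trans er)// ltr_rat.
move=> [r _ [u0 [ru h]]]; split => //=.
have [e e0 he] := cadlag_left cf u0.
have mt : (Num.max (ratr r) (u - e) < u)%R by rewrite gt_max ru gtrBl.
have [r'] := rat_in_itvoo mt.
rewrite in_itv /= gt_max => /andP[/andP[rr' er'] r'u].
rewrite -(he (ratr r')) ?er'//; apply/eqP; apply: contraTT (r'u) => /eqP fn.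
by rewrite -leNgt; apply: h; split => //; rewrite ltr_rat in rr'.
Qed.

End cadlag_paths.

Section marks.
Variables (R : realType) (A : topologicalType) (f : R -> nat) (a : R -> A).
Hypothesis cf : cadlag f.
Hypothesis ma : forall U : set A, borel A U ->
  measurable [set q : R | (0 <= q)%R /\ U (a q)].

Definition times : set R := `]0%R, +oo[%classic.
Definition slab (I : set R) : set (R * R) := I `*` `[0%R, +oo[%classic.

(** Splitting on the value of the left limit leaves countably many functions of the control
    alone. *)
Lemma measurable_along (F : nat -> A -> R) :
  (forall n, measurable_wrt (borel A) (F n)) ->
  measurable_fun times (fun u => F (left_limit f u) (a u)).
Proof.
move=> mF _ E mE.
rewrite (_ : _ `&` _ = times `&` \bigcup_n
    ([set u : R | (0 < u)%R /\ left_limit f u = n] `&`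
     [set u : R | (0 <= u)%R /\ (F n @^-1` E) (a u)])).
  apply: measurableI; first exact: measurable_itv.
  apply: bigcup_measurable => n _; apply: measurableI.
    exact: measurable_left_limit.
  by apply: ma; exact: mF.
apply/seteqP; split => u; rewrite /times /= in_itv /= andbT.
  by move=> [u0 Fu]; split => //; exists (left_limit f u) => //;
    do 2!split => //=; exact: ltW.
by move=> [u0 [n _ [[_ <-] [_ Fu]]]].
Qed.

Lemma measurable_along_fst (F : nat -> A -> R) :
  (forall n, measurable_wrt (borel A) (F n)) ->
  measurable_fun (slab times) (fun q => F (left_limit f q.1) (a q.1)).
Proof.
move=> mF; have mt : measurable times by exact: measurable_itv.
apply: (@measurable_comp _ _ _ _ _ _ times (fun u => F (left_limit f u) (a u))) => //.
- by move=> _ [q [h _] <-].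
- exact: measurable_along.
- exact: (measurable_funS measurableT _ measurable_fst).
Qed.

Lemma measurable_indic_itv (lo hi : R * R -> R) :
  measurable_fun (slab times) lo -> measurable_fun (slab times) hi ->
  measurable_fun (slab times) (fun q => \1_(`[lo q, hi q[%classic : set R) q.2 : R).
Proof.
move=> mlo mhi.
have m2 : measurable_fun (slab times) (snd : R * R -> R).
  exact: (measurable_funS measurableT _ measurable_snd).
rewrite (_ : (fun q => _) = (fun b : bool => b%:R : R) \o
    (fun q => (lo q <= q.2)%R && (q.2 < hi q)%R)).
  apply: measurableT_comp => //.
  by apply: measurable_and; [exact: measurable_fun_ler|exact: measurable_fun_ltr].
apply/funext => q /=; rewrite indicE; congr (_%:R); congr nat_of_bool.
by apply/idP/idP; rewrite inE /= in_itv.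
Qed.

Variables (b d : nat -> A -> R) (p : nat -> nat -> A -> R).
Hypothesis mb : forall n, measurable_wrt (borel A) (b n).
Hypothesis md : forall n, measurable_wrt (borel A) (d n).
Hypothesis mp : forall n k, (1 <= k)%N -> measurable_wrt (borel A) (p n k).

Lemma measurable_death_mark : measurable_fun (slab times)
  (fun q => death_mark d (left_limit f q.1) (a q.1) q.2).
Proof.
apply/measurable_EFinP; apply: measurable_indic_itv => //.
exact: measurable_along_fst.
Qed.

Lemma death_mark_ge0 n x (z : R) : 0 <= death_mark d n x z.
Proof. by rewrite lee_fin. Qed.

Lemma birth_mark_ge0 n x (z : R) : 0 <= birth_mark b p n x z.
Proof. by apply: nneseries_ge0 => k _ _; rewrite lee_fin mulr_ge0. Qed.

Lemma measurable_birth_mark : measurable_fun (slab times)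
  (fun q => birth_mark b p (left_limit f q.1) (a q.1) q.2).
Proof.
rewrite (_ : (fun q => _) = (fun q => \sum_(0 <= k <oo | k \in (leq 1))
    (k%:R * \1_(birth_interval b p k (left_limit f q.1) (a q.1)) q.2)%:E)); last first.
  by apply/funext => q; rewrite /birth_mark eseries_cond.
apply: ge0_emeasurable_sum => k; first by move=> q _ _; rewrite lee_fin mulr_ge0.
move=> _; apply/measurable_EFinP; apply: measurable_funM => //.
have mbp j : measurable_fun (slab times) (fun q =>
    b (left_limit f q.1) (a q.1) * \sum_(1 <= l < j) p (left_limit f q.1) l (a q.1))%R.
  apply: measurable_funM; first exact: measurable_along_fst.
  (* [mp] covers the indices from 1 on, while [measurable_sum] asks about every index; the guard
     reconciles the two. *)
  rewrite (_ : (fun q => _) = (fun q => \sum_(l <- index_iota 1 j)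
     (if (1 <= l)%N then p (left_limit f q.1) l (a q.1) else 0%R))%R).
    apply: measurable_sum => l; case: (leqP 1 l) => [l1|_]; last exact: measurable_cst.
    by apply: (@measurable_along_fst (fun n => p n l)) => n; exact: mp.
  apply/funext => q; rewrite !big_seq; apply: eq_bigr => l.
  by rewrite mem_index_iota => /andP[-> _].
exact: measurable_indic_itv.
Qed.

End marks.

(** * The equation after time t *)

Section paths.
Variable R : realType.
Implicit Types (mu nu : config R) (B : set (R * R)) (s t u r : R) (w : Omega R).

Lemma measurable_slab (I : interval R) : measurable (slab [set` I]).
Proof. by apply: measurableX; exact: measurable_itv. Qed.

(** After [t] the graft is the image of [nu] under translation, so that part is a change of
    variables. The part up to [t] stays expressed with the graft, ready to cancel against the
    equation at time [t]. *)
Lemma integral_graft t u mu nu (h : R * R -> \bar R) :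
  (0 <= t)%R -> (0 <= u)%R ->
  (forall q, 0 <= h q) -> measurable_fun (slab (@times R)) h ->
  \int[graft t mu nu]_(q in slab `]0%R, (t + u)%R]%classic) h q =
  \int[graft t mu nu]_(q in slab `]0%R, t]%classic) h q +
  \int[nu]_(q in slab `]0%R, u]%classic) h ((t + q.1)%R, q.2).
Proof.
move=> t0 u0 h0 mh.
pose E := slab `]t, (t + u)%R]%classic.
have E0 : slab `]0%R, (t + u)%R]%classic = slab `]0%R, t]%classic `|` E.
  apply/seteqP; split => -[v z]; rewrite /E /slab /= !in_itv /= !andbT.
    move=> [/andP[v0 vtu] z0]; have [vt|tv] := leP v t; [left|right];
    by rewrite ?v0 ?vt ?tv ?vtu ?z0.
  move=> [[/andP[-> vt] ->]|[/andP[tv ->] ->]].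
    by rewrite (le_trans vt)// lerDl.
  by rewrite (le_lt_trans t0).
have sub_times v : slab `]0%R, v]%classic `<=` slab (@times R).
  by move=> q [/= + ?]; rewrite /times /= in_itv /= => /andP[q0 _]; split => //;
    rewrite /= in_itv /= q0.
have mE : measurable E by exact: measurable_slab.
have mS (v : R) : measurable (slab `]0%R, v]%classic).
  exact: (measurable_slab `]0%R, v]).
have mT : measurable (slab (@times R)) by exact: measurable_slab.
rewrite E0 ge0_integral_setU//; last 2 first.
- by rewrite -E0; exact: measurable_funS mh.
- apply/disj_setPLR => -[v z]; rewrite /E /slab /= !in_itv /=.
  move=> [/andP[_ vt] _] [/andP[tv _] _].
  by move: tv; rewrite ltNge vt.
congr (_ + _).
pose tr (q : R * R) := ((t + q.1)%R, q.2).
have mtr : measurable_fun setT tr by exact: measurable_translate.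
have [m hm] := @pushforward_measure _ _ _ _ _ nu _ mtr.
transitivity (\int[m]_(q in E) h q).
  apply: (eq_measure_integral m) => B mB BE; rewrite hm.
  rewrite [LHS](graftE _ _ _ t0) (_ : B `&` past t = set0) ?measure0 ?add0e.
    congr (nu _); apply: setIidl => -[v z] /= Bq; have := BE _ Bq.
    by rewrite /E /slab /= !in_itv /= !andbT => -[/andP[tv _] z0]; split => //;
      move: tv; rewrite ltrDl.
  rewrite -subset0 => -[v z] [/BE]; rewrite /E /slab /past /= !in_itv /= !andbT.
  by move=> [/andP[tv _] _] [/andP[_ vt] _]; move: tv; rewrite ltNge vt.
have -> : (m : set (R * R) -> \bar R) = pushforward nu tr by apply/funext => B; exact: hm.
rewrite ge0_integral_pushforward//; last first.
  by apply: measurable_funS mh => //;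
    apply: (subset_trans _ (sub_times (t + u)%R)); rewrite E0; exact: subsetUr.
congr (integral _ _ _); apply/seteqP; split => -[v z];
  by rewrite /E /tr /slab /= !in_itv /= !andbT ltrDl lerD2l.
Qed.

(* The hypotheses force all four terms to be finite, since oo - oo = -oo. *)
Lemma ereal_increment (x y z : R) (a b c e : \bar R) :
  0 <= a -> 0 <= b -> 0 <= c -> 0 <= e ->
  y%:E = x%:E + (a + b) - (c + e) -> z%:E = x%:E + a - c ->
  y%:E = z%:E + b - e.
Proof.
case: a => [a| |] // _; case: b => [b| |] // _; case: c => [c| |] // _;
  case: e => [e| |] // _ //= [->] [->]; congr EFin.
by rewrite opprD !addrA; congr (_ - e)%R; rewrite -!addrA;
  congr (_ + (_ + _))%R; rewrite addrC.
Qed.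

Lemma ereal_increment_congr (x a a' c c' : \bar R) :
  a = a' -> c = c' -> x + a - c = x + a' - c'.
Proof. by move=> -> ->. Qed.

Variables (A : topologicalType) (b d : nat -> A -> R) (p : nat -> nat -> A -> R).

Lemma path_solves_unique x (alpha : R -> Omega R -> A) w (f g : R -> nat) :
  cadlag f -> cadlag g ->
  path_solves b d p x alpha w f -> path_solves b d p x alpha w g ->
  forall s, (0 <= s)%R -> f s = g s.
Proof.
move=> cf cg sf sg s s0; apply: contrapT => fgs.
(* Agreement before [T] passes to [T] itself, since the integrals up to [T] see the solutions only
   through their left limits. *)
have key T : (0 <= T)%R -> (forall v, (0 <= v < T)%R -> f v = g v) -> f T = g T.
  move=> T0 fg; suff : (f T)%:R%:E = (g T)%:R%:E :> \bar R.
    by move=> /eqP; rewrite eqe eqr_nat => /eqP.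
  have ll q : (`]0%R, T]%classic `*` `[0%R, +oo[%classic : set (R * R)) q ->
      left_limit f q.1 = left_limit g q.1.
    move=> [/= + _]; rewrite in_itv /= => /andP[q0 qT].
    apply: (@left_limit_ext _ f g 0%R) => // v /andP[v0 vq].
    by apply: fg; rewrite (ltW v0) (lt_le_trans vq).
  have Ef := sf T T0; have Eg := sg T T0.
  apply: (etrans Ef); apply: esym; apply: (etrans Eg); apply: esym.
  by apply: ereal_increment_congr; apply: eq_integral => q /set_mem /ll ->.
pose S := [set r : R | (0 <= r)%R /\ forall v, (0 <= v <= r)%R -> f v = g v].
have S0 : S 0%R.
  split => // v v0; have -> : v = 0%R by apply/eqP; rewrite eq_le andbC.
  by apply: key => // u /andP[u0]; rewrite ltNge u0.
have ubS : ubound S s.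
  move=> r [r0 hr]; rewrite leNgt; apply/negP => sr; apply: fgs.
  by apply: hr; rewrite s0 ltW.
have supS : has_sup S by split; [exists 0%R|exists s].
pose T := sup S.
have T0 : (0 <= T)%R by apply: ub_le_sup => //; exists s.
have fgT v : (0 <= v < T)%R -> f v = g v.
  move=> /andP[v0 vT]; have [|r [r0 hr] vr] := @sup_adherent _ S (T - v)%R _ supS.
    by rewrite subr_gt0.
  by apply: hr; rewrite v0 /=; move: vr; rewrite -/T opprB addrC subrK => /ltW.
have fgTT := key T T0 fgT.
have [e e0 he] := cadlag_right cf T0; have [e' e'0 he'] := cadlag_right cg T0.
pose m := Num.min e e'.
have m0 : (0 < m)%R by rewrite lt_min e0 e'0.
(* Both solutions are constant on [[T, T + m[], so agreement goes beyond the supremum; halving [m]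
   fits the closed intervals of [S] inside. *)
suff : S (T + m / 2)%R.
  move=> /(ub_le_sup (ex_intro _ s ubS)); rewrite -/T gerDl leNgt.
  by rewrite divr_gt0.
split; first by rewrite addr_ge0// divr_ge0// ltW.
move=> v /andP[v0 vT]; have [vT'|Tv] := ltP v T; first by apply: fgT; rewrite v0.
have vm : (v < T + m)%R.
  by apply: le_lt_trans vT _; rewrite ltrD2l ltr_pdivrMr// ltr_pMr// ltr1n.
rewrite he; last by rewrite Tv (lt_le_trans vm)// lerD2l ge_min lexx.
by rewrite he' ?fgTT// Tv (lt_le_trans vm)// lerD2l ge_min lexx orbT.
Qed.

Hypothesis mb : forall n, measurable_wrt (borel A) (b n).
Hypothesis md : forall n, measurable_wrt (borel A) (d n).
Hypothesis mp : forall n k, (1 <= k)%N -> measurable_wrt (borel A) (p n k).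

(** The equation at [t + u] minus the equation at [t]. By definition the shifted control on [w'] is
    [alpha] on the grafted path, read [t] later. *)
Lemma path_solves_shift x (alpha : R -> Omega R -> A) t w w' (f : R -> nat) :
  predictable alpha -> (0 <= t)%R -> cadlag f ->
  path_solves b d p x alpha (graft2 t w w') f ->
  path_solves b d p (f t) (shift_control alpha t w) w' (fun u => f (t + u)%R).
Proof.
move=> halpha t0 cf sf u u0.
have ma U : borel A U ->
    measurable [set q : R | (0 <= q)%R /\ U (alpha q (graft2 t w w'))].
  exact: predictable_section.
have tu0 : (0 <= t + u)%R by exact: addr_ge0.
have := sf _ tu0.
have Eb := integral_graft w.1 w'.1 t0 u0
  (fun q => birth_mark_ge0 b p (left_limit f q.1) (alpha q.1 (graft2 t w w')) q.2)
  (measurable_birth_mark cf ma mb mp).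
have Ed := integral_graft w.2 w'.2 t0 u0
  (fun q => death_mark_ge0 d (left_limit f q.1) (alpha q.1 (graft2 t w w')) q.2)
  (measurable_death_mark cf ma md).
rewrite [X in _ + X - _]Eb [X in _ + _ - X]Ed => E1.
have E2 := sf _ t0.
rewrite (ereal_increment _ _ _ _ E1 E2).
- have ll q : (`]0%R, u]%classic `*` `[0%R, +oo[%classic : set (R * R)) q ->
      left_limit (fun v => f (t + v)%R) q.1 = left_limit f (t + q.1)%R.
    move=> [/= + _]; rewrite in_itv /= => /andP[q0 _].
    exact: left_limit_shift.
  by apply: ereal_increment_congr; apply: eq_integral => q /set_mem /ll ->.
- by apply: integral_ge0 => q _; exact: birth_mark_ge0.
- by apply: integral_ge0 => q _; exact: birth_mark_ge0.
- by apply: integral_ge0 => q _; exact: death_mark_ge0.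
- by apply: integral_ge0 => q _; exact: death_mark_ge0.
Qed.

End paths.

(** * Conditioning on the stopped sigma-algebra *)

Section conditioning.
Variable R : realType.
Implicit Types (s t r : R) (w : Omega R).

Lemma agree_le s t (mu nu : config R) : (s <= t)%R -> agree t mu nu -> agree s mu nu.
Proof.
move=> st a B mB [r Br]; apply: a => //; exists r.
by apply: subset_trans Br _; exact: box_mono.
Qed.

Lemma agree2_le s t w w' : (s <= t)%R -> agree2 t w w' -> agree2 s w w'.
Proof. by move=> st [a1 a2]; split; exact: (agree_le st). Qed.

Lemma agree_graft_past s t (mu mu' nu : config R) : (0 <= t)%R ->
  agree t mu mu' -> agree s (graft t mu nu) (graft t mu' nu).
Proof.
move=> t0 a B mB [r Br]; rewrite !graftE//; congr (_ + _); apply: a.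
  by apply: measurableI => //; exact: measurable_past.
by exists r => -[u z] [/Br [_ ?] [? _]].
Qed.

Lemma agree2_graft2_past s t w v w' : (0 <= t)%R ->
  agree2 t w v -> agree2 s (graft2 t w w') (graft2 t v w').
Proof. by move=> t0 [a1 a2]; split; exact: agree_graft_past. Qed.

Lemma filtration_value (T : Type) s (Z : Omega R -> T) w w' :
  (forall B, filtration s (Z @^-1` B)) -> agree2 s w w' -> Z w = Z w'.
Proof.
by move=> hZ a; have := filtration_agree (hZ [set Z w]) a erefl.
Qed.

(** Stopping the path at [t] preserves the event [tau <= t] and, on it, the value of [Y]; so
    [filtration_of_stop2] applies. *)
Lemma filtration_at_measurable_wrt (tau : Omega R -> R) (Y : Omega R -> \bar R) :
  stopping_time tau -> (forall w, (0 <= tau w)%R) ->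
  measurable_fun setT (Y : config R * config R -> \bar R) ->
  (forall w v, agree2 (tau w) w v -> Y w = Y v) ->
  measurable_wrt (filtration_at tau) Y.
Proof.
move=> htau tau0 mY hY E mE.
have mYE : measurable (Y @^-1` E) by have := mY measurableT _ mE; rewrite setTI.
split => // t t0; apply: filtration_of_stop2 => //.
  apply: measurableI => //; exact: (filtration_measurable t0 (htau t t0)).
move=> w; have a : agree2 t w (stop2 t w) by exact: agree2_graft2.
have key : (tau w <= t)%R -> Y (stop2 t w) = Y w.
  by move=> wt; symmetry; apply: hY; exact: agree2_le a.
split => -[/= Yw wt].
  split => /=; first by rewrite key.
  exact: (filtration_agree (htau t t0) a wt).
have wt' : (tau w <= t)%R := filtration_agree (htau t t0) (agree2_sym a) wt.
by split => //=; rewrite -key.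
Qed.

End conditioning.

Section strong_markov.
Variables (R : realType) (Q : probability (config R) R).
Hypothesis hQ : poisson_random_measure_law Q.
Variable tau : Omega R -> R.
Hypothesis htau : stopping_time tau.
Hypothesis tau0 : forall w, (0 <= tau w)%R.
Let P : probability (config R * config R)%type R := Q \x Q.

(** Change of variables along Phi, which preserves the law, followed by Tonelli. *)
Lemma integral_grafted (Z : config R * config R -> \bar R) :
  measurable_fun setT Z -> (forall w, 0 <= Z w) ->
  \int[P]_w Z w = \int[P]_wbar \int[P]_w Z (grafted tau (wbar, w)).
Proof.
move=> mZ Z0; have mg := measurable_grafted htau tau0.
have [m hm] := @pushforward_measure _ _ _ _ _ (P \x P) _ mg.
transitivity (\int[m]_w Z w).
  by apply: eq_measure_integral => E mE _; rewrite hm; symmetry; exact: grafted_law.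
have -> : (m : set (config R * config R) -> \bar R) = pushforward (P \x P) (grafted tau).
  by apply/funext => B; exact: hm.
rewrite ge0_integral_pushforward// preimage_setT fubini_tonelli1//.
  exact: measurableT_comp.
by move=> q; exact: Z0.
Qed.

(** Paths that agree up to [tau] have the same continuations, whence the measurability. An event of
    the stopped sigma-algebra holds for [wbar] exactly when it holds for its grafts, so its
    indicator leaves the inner integral. *)
Lemma cond_expectation_grafted s (Z : config R * config R -> \bar R) :
  (0 <= s)%R -> (forall B, filtration s (Z @^-1` B)) -> (forall w, 0 <= Z w) ->
  cond_expectation (Q \x Q) (filtration_at tau) Z
    (fun wbar => \int[P]_w Z (grafted tau (wbar, w))).
Proof.
move=> s0 hZ Z0; have mg := measurable_grafted htau tau0.
have mZ : measurable_fun setT Z.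
  by move=> _ B mB; rewrite setTI; exact: (filtration_measurable s0 (hZ B)).
have mZg : measurable_fun setT (Z \o grafted tau) by exact: measurableT_comp.
split.
- by move=> w; exact: integral_ge0.
- apply: filtration_at_measurable_wrt => //.
    apply: (@measurable_fun_fubini_tonelli_F _ _ _ _ R P (Z \o grafted tau)) => //.
    by move=> q; exact: Z0.
  move=> w v a; apply: eq_integral => w' _; apply: (filtration_value hZ).
  rewrite /grafted /= (stopping_time_agree htau tau0 a).
  by apply: agree2_graft2_past.
move=> B FB; have mB : measurable B by case: FB.
rewrite [RHS]integral_mkcond [RHS]integral_grafted; last 2 first.
- by apply/(measurable_restrictT _ mB); exact: measurable_funS mZ.
- by move=> w; exact: erestrict_ge0.
rewrite [LHS]integral_mkcond; apply: eq_integral => wbar _.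
rewrite patchE; case: ifPn => [/set_mem Bw|/negP nB].
  apply: eq_integral => w _; rewrite patchE ifT//; apply/mem_set.
  exact: ((filtration_at_agree htau tau0 FB (agree2_graft2 wbar w (tau0 wbar))).1 Bw).
symmetry; apply: integral0_eq => w _; rewrite patchE ifF//; apply/negP => /set_mem h.
apply: nB; apply/mem_set.
exact: ((filtration_at_agree htau tau0 FB (agree2_graft2 wbar w (tau0 wbar))).2 h).
Qed.

(** The preimage of a null set under Phi is null for [P \x P], and almost all sections of a null set
    are null. *)
Lemma ae_grafted (G : set (config R * config R)) :
  {ae P, forall w, G w} ->
  {ae P, forall wbar, {ae P, forall w, G (grafted tau (wbar, w))}}.
Proof.
move=> [N [mN PN0 GN]]; have mg := measurable_grafted htau tau0.
pose N' := grafted tau @^-1` N.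
have mN' : measurable N' by have := mg measurableT _ mN; rewrite setTI.
have PN' : (P \x P) N' = 0 by rewrite -PN0; exact: grafted_law.
have mx : measurable_fun setT (P \o xsection N') by exact: measurable_fun_xsection.
have : ae_eq P setT (P \o xsection N') (cst 0).
  apply/ae_eq_integral_abs => //; rewrite -[RHS]PN'.
  by apply: eq_integral => w _; rewrite gee0_abs.
apply: filterS => wbar /(_ Logic.I) /= h.
exists (xsection N' wbar); split => //; first exact: measurable_xsection.
by move=> w nG; apply/mem_set; apply: GN.
Qed.

End strong_markov.

(** * Identification of the conditional expectation with the restarted process *)

Theorem lemma10 (R : realType) (A : topologicalType)
    (b d : nat -> A -> R) (p : nat -> nat -> A -> R)
    (Q : probability (config R) R)
    (X : nat -> (R -> Omega R -> A) -> R -> Omega R -> option nat)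
    (bbar M : R) (dbar : nat -> R)
    (hA : polish R A)
    (hb0 : forall n a, (0 <= b n a)%R)
    (hd0 : forall n a, (0 <= d n a)%R)
    (hp01 : forall n k a, (1 <= k)%N -> (0 <= p n k a <= 1)%R)
    (hp1 : forall n a, \sum_(1 <= k <oo) (p n k a)%:E = 1)
    (hb00 : forall a, b 0%N a = 0%R)
    (hd00 : forall a, d 0%N a = 0%R)
    (hQ : poisson_random_measure_law Q)
    (hX : forall (x : nat) (alpha : R -> Omega R -> A), predictable alpha ->
       controlled_process b d p Q x alpha (X x alpha))
    (mb : forall n, measurable_wrt (borel A) (b n))
    (md : forall n, measurable_wrt (borel A) (d n))
    (mp : forall n k, (1 <= k)%N -> measurable_wrt (borel A) (p n k))
    (hbbar : (0 < bbar)%R)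
    (hb : forall n a, (b n a <= bbar * n%:R)%R)
    (hdbar : forall n, (0 <= dbar n)%R)
    (hd : forall n a, (d n a <= dbar n)%R)
    (hM : (0 < M)%R)
    (hp : forall n a, \sum_(1 <= k <oo) (k%:R * p n k a)%:E <= M%:E)
    (x : nat) (alpha : R -> Omega R -> A) (halpha : predictable alpha)
    (s : R) (hs : (0 <= s)%R)
    (tau : Omega R -> R) (htau : stopping_time tau)
    (htau_s : forall w, (0 <= tau w <= s)%R)
    (phi : nat -> R) (hphi : forall n, (0 <= phi n)%R) :
  exists Y : Omega R -> \bar R,
    cond_expectation (Q \x Q) (filtration_at tau)
      (fun w => extend0 phi (X x alpha s w)) Y /\
    {ae (Q \x Q), forall wbar,
      Y wbar =
        if X x alpha (tau wbar) wbar is Some n then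
          \int[Q \x Q]_w
             extend0 phi (X n (shift_control alpha (tau wbar) wbar)
                            (s - tau wbar)%R w)
        else 0}.
Proof.
have tau0 w : (0 <= tau w)%R by have /andP[] := htau_s w.
have taus w : (tau w <= s)%R by have /andP[] := htau_s w.
pose P : probability (config R * config R)%type R := Q \x Q.
pose Z w := extend0 phi (X x alpha s w).
have extend0_ge0 n : 0 <= extend0 phi n by case: n => [n|] //=; rewrite lee_fin.
have mext beta n r : predictable beta -> (0 <= r)%R ->
    measurable_fun setT (fun w : config R * config R => extend0 phi (X n beta r w)).
  move=> pbeta r0 _ B mB; rewrite setTI; have [hF _] := hX n beta pbeta.
  exact: (filtration_measurable r0 (hF r (extend0 phi @^-1` B) r0)).
have [adapted good] := hX x alpha halpha.
exists (fun wbar => \int[P]_w Z (grafted tau (wbar, w))); split.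
  apply: (cond_expectation_grafted hQ htau tau0 hs) => // B.
  exact: (adapted s (extend0 phi @^-1` B) hs).
have := ae_grafted hQ htau tau0 good; apply: filterS => wbar goodw.
set t := tau wbar; have t0 : (0 <= t)%R by exact: tau0.
have Xt w : X x alpha t wbar = X x alpha t (graft2 t wbar w).
  apply: (filtration_value (s := t)) => [B|]; first exact: adapted.
  exact: agree2_graft2.
(* The good continuations have probability 1, so one exists; it already forces the state at [t] to
   be an integer. *)
have [w0 [f0 [Xf0 _ _]]] : exists w, exists f : R -> nat,
    [/\ forall r, (0 <= r)%R -> X x alpha r (graft2 t wbar w) = Some (f r), cadlag f
      & path_solves b d p x alpha (graft2 t wbar w) f].
  apply: filter_ex goodw; apply: ae_properfilter_algebraOfSetsType.
  exact: (eq_ind_r (fun z : \bar R => 0 < z) lte01 (probability_setT P)).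
rewrite (Xt w0) (Xf0 t t0).
have pshift : predictable (shift_control alpha t wbar).
  exact: predictable_shift_control.
have [_ good'] := hX (f0 t) _ pshift.
have mg := measurable_grafted htau tau0.
apply: ge0_ae_eq_integral => //.
- rewrite /Z; apply: (measurableT_comp (mext alpha x s halpha hs)).
  exact: (measurableT_comp mg (measurable_pair1 wbar)).
- by apply: mext => //; rewrite subr_ge0; exact: taus.
- by move=> w _; exact: extend0_ge0.
move: goodw good'; apply: filterS2 => w [f [Xf cf sf]] [g [Xg cg sg]] _.
(* All good continuations pass through the same integer at time [t], which is the initial state of
   the restarted process. *)
have fg0 : f t = f0 t.
  by have [] := etrans (esym (Xf t t0)) (etrans (esym (Xt w)) (etrans (Xt w0) (Xf0 t t0))).
have st0 : (0 <= s - t)%R by rewrite subr_ge0; exact: taus.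
have sf' := path_solves_shift mb md mp halpha t0 cf sf.
rewrite fg0 in sf'.
(* Both paths solve the restarted equation driven by [w]; they are compared at time [s - t], which
   is time [s] for the grafted path. *)
have := path_solves_unique cg (cadlag_shift t0 cf) sg sf' st0.
by rewrite /Z (Xf s hs) (Xg _ st0) => ->; rewrite addrC subrK.
Qed.
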